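(* Let $j,k\ge0$ be integers, $m:=j+k+1$, and $t>0$. Then $$\log\mathbb{P}\{\mathrm{CR}_t\le k,\ \mathrm{NE}_t\le j\}=\int_0^t\pi_{2j+1,m}(0;\tau)\,d\tau+\int_0^t\int_0^s\mathcal{Q}_j^m(\tau)\,d\tau\,ds,$$ where $$\mathcal{Q}_j^m(\tau):=-\big(\pi_{2j,m}(0;\tau)\pi_{2j+2,m}(0;\tau)+|\pi_{2j+1,m}(0;\tau)|^2\big)+\pi_{2j,m}(0;\tau)\pi_{2j+2,m}(0;\tau)|\pi_{2j+1,m}(0;\tau)|^2.$$
   Context: Matchings. For an integer $n\ge 0$, $\mathcal{M}_n$ is the set of complete matchings of $[2n]=\{1,\dots,2n\}$, i.e. partitions $M=\{(i_1,j_1),\dots,(i_n,j_n)\}$ of $[2n]$ into pairs with $i_a<j_a$; $|\mathcal{M}_n|=(2n-1)!!$. A subset $\{(i_{s_1},j_{s_1}),\dots,(i_{s_r},j_{s_r})\}$ of $M$ is an $r$-crossing if $i_{s_1}<i_{s_2}<\dots<i_{s_r}<j_{s_1}<j_{s_2}<\dots<j_{s_r}$, and an $r$-nesting if $i_{s_1}<i_{s_2}<\dots<i_{s_r}<j_{s_r}<\dots<j_{s_2}<j_{s_1}$. $\mathrm{cr}_n(M)$ (resp. $\mathrm{ne}_n(M)$) is the largest $r$ such that $M$ has an $r$-crossing (resp. $r$-nesting), with $\mathrm{cr}_0=\mathrm{ne}_0=0$. $\mathcal{M}_n$ carries the uniform probability. For $t>0$ let $\mathcal{N}$ be a Poisson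 random variable with parameter $t^2/2$ and, conditionally on $\mathcal{N}=n$, pick a uniform random matching in $\mathcal{M}_n$; $\mathrm{CR}_t:=\mathrm{cr}_{\mathcal{N}}$ and $\mathrm{NE}_t:=\mathrm{ne}_{\mathcal{N}}$ are its maximal crossing and nesting (both computed on the same matching). Orthogonal polynomials. For $m\ge1$ and $t\ge0$ let $\omega:=e^{\pi i/m}$ and let $\mu_m$ be the discrete measure on the unit circle $$d\mu_m(z):=\frac1{2m}\sum_{r=0}^{2m-1}e^{t(z+z^{-1})}\delta_{\omega^r}(z).$$ For $0\le n\le 2m$, $\pi_{n,m}(z)=\pi_{n,m}(z;t)$ is the monic polynomial of degree $n$ determined by $$\oint_{|z|=1}z^{-\ell}\pi_{n,m}(z;t)\,d\mu_m(z)=0,\qquad 0\le\ell<n.$$ *)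

(* Defs.v *)
From HB Require Import structures.
From mathcomp Require Import all_boot all_order all_algebra.
From mathcomp Require Import complex.
From mathcomp Require Import all_classical all_reals all_analysis.

Set Implicit Arguments.
Unset Strict Implicit.
Unset Printing Implicit Defensive.

Import Order.TTheory GRing.Theory Num.Theory.

Local Open Scope classical_set_scope.
Local Open Scope ring_scope.

(* [2n] is represented by 'I_n.*2, i.e. shifted to {0, ..., 2n-1}; crossings
   and nestings depend only on the order. *)
Definition is_matching (n : nat) (M : {set 'I_n.*2 * 'I_n.*2}) : bool :=
  [forall p in M, (p.1 < p.2)%N] &&
  finset.partition [set [set p.1; p.2]%SET | p in M]%SET [set: 'I_n.*2]%SET.

Definition matching (n : nat) : Type :=
  {M : {set 'I_n.*2 * 'I_n.*2} | is_matching M}.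

HB.instance Definition _ (n : nat) := Finite.on (matching n).

(* The sequence s lists the pairs (i_1, j_1), ..., (i_r, j_r) of S so that
   i_1 < ... < i_r < j_1 < ... < j_r. *)
Definition is_crossing (N r : nat) (S : {set 'I_N * 'I_N}) : bool :=
  [exists s : r.-tuple ('I_N * 'I_N), (S == [set p in s]%SET) &&
    sorted ltn ([seq val p.1 | p <- s] ++ [seq val p.2 | p <- s])].

(* Same, with i_1 < ... < i_r < j_r < ... < j_1. *)
Definition is_nesting (N r : nat) (S : {set 'I_N * 'I_N}) : bool :=
  [exists s : r.-tuple ('I_N * 'I_N), (S == [set p in s]%SET) &&
    sorted ltn ([seq val p.1 | p <- s] ++ rev [seq val p.2 | p <- s])].

Definition cr (n : nat) (M : matching n) : nat :=
  \max_(S : {set 'I_n.*2 * 'I_n.*2} | (S \subset val M) && is_crossing #|S| S)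
    #|S|.

Definition ne (n : nat) (M : matching n) : nat :=
  \max_(S : {set 'I_n.*2 * 'I_n.*2} | (S \subset val M) && is_nesting #|S| S)
    #|S|.

Definition cond_prob (R : realType) (d : measure_display)
    (T : measurableType d) (P : probability T R) (A B : set T) : R :=
  fine (P (A `&` B)) / fine (P B).

(* X is a random matching whose size tag X is Poisson with parameter t^2/2 and
   which, given tag X = n, is uniform among the matchings of size n. The
   countable type of all matchings carries the discrete sigma-algebra. *)
Record poissonized_matching (R : realType) (d : measure_display)
    (T : measurableType d) (P : probability T R) (t : R)
    (X : T -> {n : nat & matching n}) : Prop := PoissonizedMatching {
  pm_measurable : forall A : set {n : nat & matching n}, measurable (X @^-1` A);
  pm_poisson : forall n : nat,
    P [set w | tag (X w) = n] = (poisson_pmf (t ^+ 2 / 2) n)%:E;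
  pm_uniform : forall (n : nat) (M : matching n),
    cond_prob P [set w | X w = Tagged matching M] [set w | tag (X w) = n]
    = #|{: matching n}|%:R^-1 }.

Definition CR (T : Type) (X : T -> {n : nat & matching n}) (w : T) : nat :=
  cr (tagged (X w)).

Definition NE (T : Type) (X : T -> {n : nat & matching n}) (w : T) : nat :=
  ne (tagged (X w)).

Section orthogonal_polynomials.
Variable R : realType.
Local Open Scope complex_scope.

Definition cexp (z : R[i]) : R[i] :=
  (expR (complex.Re z))%:C * (cos (complex.Im z) +i* sin (complex.Im z)).

Definition omega (m : nat) : R[i] := cexp (0 +i* (pi / m%:R)).

(* The integral of f against the discrete measure
   (2m)^-1 \sum_r e^(t (z + 1/z)) \delta_(omega^r). *)
Definition mu_integral (m : nat) (t : R) (f : R[i] -> R[i]) : R[i] :=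
  (m.*2)%:R^-1 * \sum_(r < m.*2)
    (let z := omega m ^+ r in cexp (t%:C * (z + z^-1)) * f z).

Definition is_orthopoly (n m : nat) (t : R) (p : {poly R[i]}) : Prop :=
  [/\ p \is monic, size p = n.+1
    & forall l : nat, (l < n)%N ->
        mu_integral m t (fun z => z ^- l * p.[z]) = 0].

(* For 0 < m and n <= 2m there is exactly one such polynomial: the measure has
   positive mass at each of the 2m points of its support. *)
Definition orthopoly (n m : nat) (t : R) : {poly R[i]} :=
  xget 0 [set p | is_orthopoly n m t p].

Definition cintegral (a b : R) (f : R -> R[i]) : R[i] :=
  (\int[@lebesgue_measure R]_(x in `[a, b]) complex.Re (f x))
  +i* (\int[@lebesgue_measure R]_(x in `[a, b]) complex.Im (f x)).

Definition Qfun (j m : nat) (tau : R) : R[i] :=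
  let p := fun n => (orthopoly n m tau).[0] in
  - (p j.*2 * p j.*2.+2 + `|p j.*2.+1| ^+ 2)
  + p j.*2 * p j.*2.+2 * `|p j.*2.+1| ^+ 2.

End orthogonal_polynomials.

(* Main.v *)
(* Scan a matching from its last point to its first and row-insert the openers
   of the arcs met at their closers: the shapes of the resulting tableaux form a
   closed walk from the empty diagram, and by Schensted's theorem the crossing
   and nesting numbers are the largest numbers of rows and of columns met.  So
   the matchings with cr <= k and ne <= j are the closed walks of length 2n in
   the diagrams inside a k x j box.  Read by columns, such a walk moves j
   non-colliding particles on a path with m - 1 = j + k sites; its exponential
   generating function is the minor D_j = det (h_{a-b} - h_{a+b}), 1 <= a, b <= j,
   of exp(tA), where A is the adjacency matrix of the path and h_l are the moments
   of mu_m.  Hence the probability is exp(-t^2/2) D_j(t).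

   On the other side let x_n = pi_n(0) and let N_n be the squared norm of pi_n.
   The antisymmetrisations of z^{-s} pi_{2s} are orthogonal, which gives
   D_j = prod_{s=1..j} N_{2s} / (1 - x_{2s}).  The Schur flow
     x_n' = (1 - x_n^2) (x_{n+1} - x_{n-1}),   N_n' = - 2 x_n x_{n+1} N_n
   then yields (log D_j)' = x_{2j+1} - sum_{n=0..2j} x_n x_{n+1}, and the
   derivative of the last sum telescopes to - 1 - Q. *)

Require Import Defs.
From mathcomp Require Import all_boot all_order all_algebra.
From mathcomp Require Import complex.
From mathcomp Require Import all_classical all_reals all_analysis.
From mathcomp Require Import perm ring lra zify.

Set Implicit Arguments.
Unset Strict Implicit.
Unset Printing Implicit Defensive.

(** * Longest increasing subsequences and bumping *)

(** Along the scan entries are both inserted and deleted, so Schensted's theorem needs a form that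
    survives both moves: [lis_compat]. Matchings are not put in bijection with walks. The numbers of
    admissible continuations are summed over all tableaux of one shape; bijectivity of insertion
    gives this sum the recursion of walk counts, and the empty shape has a single tableau. The
    generating function is identified with the minor through a linear differential system indexed by
    shapes. The minors solve it because a forbidden move makes two rows equal (collision) or one row
    null (wall 0 or m), and a Taylor remainder estimate shows that such a solution is the generating
    function. The norms N_n are positive only for n < 2m. Since 2j+1 < 2m the Schur flow is
    available up to x_{2j+1}; x_{2j+2}, which is x_{2m} when k = 0, enters only its right-hand side.
    The Poisson weight (t^2/2)^n / n! over the number of matchings is exp-free t^{2n} / (2n)!, which
    is why an exponential generating function appears. The constant -1 in the telescoped sum is
    cancelled by the derivative of the factor exp(-t^2/2), and integration constants vanish because
    pi_n = z^n at t = 0 for n < 2m. *)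

Fixpoint lis_from (lo : nat) (s : seq nat) : nat :=
  if s is x :: s' then
    if lo <= x then maxn (lis_from lo s') (lis_from x.+1 s').+1
    else lis_from lo s'
  else 0.

Lemma lis_fromP (lo r : nat) (s : seq nat) :
  reflect (exists s', [/\ subseq s' s, sorted ltn s', all (leq lo) s' & size s' = r])
          (r <= lis_from lo s).
Proof.
elim: s lo r => [|x s IH] lo r /=.
  apply: (iffP idP) => [|[s' [/eqP-> _ _ <-]]] //.
  by rewrite leqn0 => /eqP->; exists [::].
apply: (iffP idP).
  case: ifP => lox.
    rewrite leq_max => /orP[/IH[s' [h1 h2 h3 h4]]|].
      by exists s'; split => //; exact: subseq_trans h1 (subseq_cons _ _).
    case: r => [_|r]; first by exists [::]; split; rewrite ?sub0seq.
    rewrite ltnS => /IH[s' [h1 h2 h3 h4]].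
    exists (x :: s'); split; rewrite ?eqxx //=; last by rewrite h4.
      rewrite path_sortedE; last exact: ltn_trans.
      by rewrite h3.
    rewrite lox /=; apply: sub_all h3 => z; apply: leq_trans; exact: leqW.
  move=> /IH[s' [h1 h2 h3 h4]].
  by exists s'; split => //; exact: subseq_trans h1 (subseq_cons _ _).
case=> -[|y s'] [h1 h2 h3 <-] //.
have key : subseq (y :: s') s -> size (y :: s') <= lis_from lo s.
  by move=> hs; apply/IH; exists (y :: s').
move: h1; case: eqP => [yx|_] h1; last first.
  by apply: leq_trans (key h1) _; case: ifP => // _; rewrite leq_maxl.
subst y; move: h3 => /= /andP[-> h3].
rewrite leq_max; apply/orP; right => /=.
apply/IH; exists s'; split => //; first exact: path_sorted h2.
by move: h2 => /=; rewrite path_sortedE => [/andP[]//|]; exact: ltn_trans.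
Qed.

Lemma lis_from_anti (lo lo' : nat) (s : seq nat) :
  lo <= lo' -> lis_from lo' s <= lis_from lo s.
Proof.
elim: s lo lo' => //= x s IH lo lo' h.
have := IH _ _ h; do 2!case: ifP => ?; lia.
Qed.

(** A strictly increasing chain has at most [d] entries among [lo, ..., lo + d - 1]. *)
Lemma lis_from_drop (lo d : nat) (s : seq nat) :
  lis_from lo s <= lis_from (lo + d) s + d.
Proof.
elim: s lo d => //= x s IH lo d.
have := IH lo d.
have := IH x.+1 (lo + d - x.+1).
case: (leqP lo x) => h1; case: (leqP (lo + d) x) => h2; try lia.
by rewrite subnKC //; lia.
Qed.

Lemma lis_from_dropW (lo lo' : nat) (s : seq nat) :
  lo <= lo' -> lis_from lo s <= lis_from lo' s + (lo' - lo).
Proof. by move=> h; have := lis_from_drop lo (lo' - lo) s; rewrite subnKC. Qed.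

(** The trace of a bumping path on the word of row indices, smallest entry first: the entry pushed
    out of row [c] enters row [c.+1] and pushes out the next larger entry there, which is the next
    letter [c.+1]. *)
Fixpoint bumpw (c : nat) (s : seq nat) : seq nat :=
  if s is x :: s' then
    if x == c then c.+1 :: bumpw c.+1 s' else x :: bumpw c s'
  else [::].

(* A chain of [bumpw c s] starting with a bumped letter [c + i.+1] can be extended
   to the left by the [i] letters bumped before it: hence the subtracted term. *)
Lemma lis_bump (lo c : nat) (s : seq nat) :
  lis_from lo (bumpw c s) =
  maxn (lis_from lo s) (lis_from c s - (lo - c.+1)).
Proof.
elim: s lo c => [|x s IH] lo c //=.
case: ifPn => [/eqP->|xc] /=.
  rewrite !IH leqnn.
  have := @lis_from_anti c c.+1 s (leqnSn _).
  have := @lis_from_anti c.+1 c.+2 s (leqnSn _).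
  have := @lis_from_dropW c c.+1 s (leqnSn _).
  have := @lis_from_dropW c.+1 c.+2 s (leqnSn _).
  case: (leqP lo c) => h1.
    have := @lis_from_anti _ _ s h1.
    have := @lis_from_dropW _ _ s h1.
    by rewrite (leqW h1); lia.
  have := @lis_from_anti _ _ s h1.
  have := @lis_from_dropW _ _ s h1.
  by case: (leqP lo c.+1) => h2; lia.
rewrite !IH.
case: (leqP lo x) => h1; case: (leqP c x) => h2.
- have := @lis_from_anti lo x.+1 s (leqW h1).
  have := @lis_from_dropW lo x.+1 s (leqW h1).
  have := @lis_from_anti c x.+1 s (leqW h2).
  have := @lis_from_dropW c x.+1 s (leqW h2).
  lia.
- have := @lis_from_anti lo x.+1 s (leqW h1).
  have := @lis_from_anti x.+1 c s h2.
  have := @lis_from_dropW x.+1 c s h2.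
  lia.
- have := @lis_from_anti x.+1 lo s h1.
  have := @lis_from_dropW x.+1 lo s h1.
  have := @lis_from_anti c x.+1 s (leqW h2).
  have := @lis_from_dropW c x.+1 s (leqW h2).
  lia.
- have := @lis_from_anti x.+1 lo s h1.
  have := @lis_from_dropW x.+1 lo s h1.
  lia.
Qed.

(** At [lo = 0] the right-hand side has the form found in [lis_insert_min]: a letter 0 followed by
    its bumping path lengthens chains exactly as a new minimum does. This agreement is the induction
    step of Schensted's theorem for the number of rows. *)
Lemma lis_insert_bump (lo : nat) (s u : seq nat) :
  lis_from lo (s ++ 0 :: bumpw 0 u) =
  maxn (lis_from lo (s ++ u)) ((lis_from 0 u).+1 - lo).
Proof.
elim: s lo => [|x s IH] lo /=.
  rewrite !lis_bump leqn0.
  have := @lis_from_anti 0 lo u (leq0n _).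
  have := @lis_from_anti 0 1 u (leq0n _).
  by case: ifP => /eqP h; rewrite ?h; lia.
rewrite !IH; case: ifP => h; lia.
Qed.

Lemma lis_insert_min (lo m : nat) (s u : seq nat) :
  lo <= m -> all (ltn m) s -> all (ltn m) u ->
  lis_from lo (s ++ m :: u) = maxn (lis_from lo (s ++ u)) (lis_from lo u).+1.
Proof.
move=> lom hs hu; elim: s lo lom hs => [|x s IH] lo lom /=.
  move=> _; rewrite lom.
  suff -> : lis_from m.+1 u = lis_from lo u by [].
  elim: u hu => //= x u IHu /andP[h1 h2].
  by rewrite h1 IHu // (leq_trans lom (ltnW h1)).
move=> /andP[h1 h2]; rewrite (leq_trans lom (ltnW h1)) IH //.
suff -> : lis_from x.+1 (s ++ m :: u) = lis_from x.+1 (s ++ u) by lia.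
elim: (s) x h1 {IH} => [|y s' IH'] x h1 /=.
  by rewrite ltnNge (ltnW h1).
by case: ifP => h3; rewrite !IH' //; lia.
Qed.

(** * Row insertion on lattice words *)

(* A standard tableau is encoded by the word of the row indices of its entries,
   the largest entry first, so that [behead] removes the largest entry. *)
Fixpoint latt (Y : seq nat) : bool :=
  if Y is x :: Y' then
    latt Y' && ((x == 0) || (count_mem x Y' < count_mem x.-1 Y'))
  else true.

(* Row insertion of a new entry larger than exactly [r] entries of the tableau
   (which are standardised accordingly); the second component is the row of the
   new cell. *)
Fixpoint ins (r : nat) (Y : seq nat) : seq nat * nat :=
  if Y is x :: Y' then
    if r == size Y then (0 :: Y, 0) else
    let: (Z, c) := ins r Y' in
    if x == c then (c.+1 :: Z, c.+1) else (x :: Z, c)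
  else ([:: 0], 0).

Lemma latt_count (c : nat) (Y : seq nat) :
  latt Y -> count_mem c.+1 Y <= count_mem c Y.
Proof.
elim: Y => //= x Y IH /andP[/IH h1 h2].
case: (altP (x =P c.+1)) => [e|n1]; last by lia.
have /negbTE n2 : c.+1 != c by lia.
by move: h2; rewrite e /= n2; lia.
Qed.

Lemma count_ins (r d : nat) (Y : seq nat) :
  count_mem d (ins r Y).1 = count_mem d Y + ((ins r Y).2 == d).
Proof.
elim: Y => [|x Y IH]; first by rewrite /= addnC.
rewrite [ins _ _]/=; case: ifP => _; first by rewrite /= addnC.
move: IH; case: (ins r Y) => Z c /= IH.
by case: (altP (x =P c)) => [->|n] /=; rewrite IH; lia.
Qed.

Lemma size_ins (r : nat) (Y : seq nat) : size (ins r Y).1 = (size Y).+1.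
Proof.
elim: Y => //= x Y IH; case: ifP => // _.
by move: IH; case: (ins r Y) => Z c /= IH; case: ifP; rewrite /= IH.
Qed.

Lemma latt_ins (r : nat) (Y : seq nat) : latt Y -> latt (ins r Y).1.
Proof.
elim: Y => //= x Y IH /andP[lY hx]; case: ifP => _; first by rewrite /= lY hx.
move: (IH lY) (fun d => count_ins r d Y) (fun c => @latt_count c _ lY).
case: (ins r Y) => Z c /= lZ cZ aY.
case: (altP (x =P c)) => [e|n] /=; rewrite lZ /=.
  have /negbTE n2 : c != c.+1 by lia.
  by rewrite !cZ n2; have := aY c; lia.
by case/orP: hx => [->//|h]; rewrite !cZ; apply/orP; right; lia.
Qed.

(* Insertion is invertible once the row of the new cell is known. *)
Lemma ins_inj (r r' : nat) (Y Y' : seq nat) :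
  r <= size Y -> r' <= size Y' -> ins r Y = ins r' Y' -> r = r' /\ Y = Y'.
Proof.
move=> hr hr' E.
have eS : size Y = size Y' by apply: succn_inj; rewrite -(size_ins r) -(size_ins r') E.
elim: Y Y' r r' hr hr' eS E => [|x Y IH] [|x' Y'] r r' //=.
  by rewrite !leqn0 => /eqP-> /eqP->.
move=> hr hr' [eS].
have := IH Y' r r' _ _ eS.
have szr := size_ins r Y; have szr' := size_ins r' Y'.
move: szr szr'; case: (ins r Y) => Z c; case: (ins r' Y') => Z' c' /= s1 s2 IH'.
case: (altP (r =P _)) => [->|n]; case: (altP (r' =P _)) => [->|n'].
- by rewrite eS => -[-> ->].
- by case: (altP (x' =P c')) => [e|n2] [] // e0 _ e2; move: n2; rewrite -e0 -e2 eqxx.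
- by case: (altP (x =P c)) => [e|n2] [] // e0 _ e2; move: n2; rewrite e0 e2 eqxx.
have {}IH' : (Z, c) = (Z', c') -> r = r' /\ Y = Y' by apply: IH'; lia.
case: (altP (x =P c)) => [->|n1]; case: (altP (x' =P c')) => [->|n2].
- by move=> [ec eZ _]; have [|-> ->] := IH'; rewrite ?ec ?eZ.
- by move=> [e1 _ e2]; move: n2; rewrite -e1 -e2 eqxx.
- by move=> [e1 _ e2]; move: n1; rewrite e1 e2 eqxx.
by move=> [ec eZ ed]; have [|-> ->] := IH'; rewrite ?ec ?eZ ?ed.
Qed.

(** Reverse bumping from the corner that ends row [c]. If the largest entry occupies this corner, it
    was bumped out of row [c.-1], or is the inserted entry itself when [c = 0]; otherwise it is set
    aside. *)
Lemma ins_surj (c : nat) (Z : seq nat) :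
  latt Z -> count_mem c.+1 Z < count_mem c Z ->
  exists Y r, [/\ latt Y, r <= size Y & ins r Y = (Z, c)].
Proof.
elim: Z c => //= x Z IH c /andP[lZ hx].
have aZ := fun d => @latt_count d _ lZ.
case: (altP (x =P c)) => [e|n] /=.
  case: c e => [|c] e hc.
    exists Z, (size Z); split => //; rewrite e; case: (Z) => //= y Z'.
    by rewrite eqxx.
  rewrite e /= in hx.
  have [Y [r [lY hr E]]] := IH c lZ hx.
  have cZ d := count_ins r d Y; rewrite E /= in cZ.
  exists (c :: Y), r; split => /=; last 2 first.
  - exact: leqW.
  - by rewrite E eqxx ifN ?e //; lia.
  rewrite lY /=; case: (c) cZ hx aZ => // c' cZ hx aZ; apply/orP; right => /=.
  by have := aZ c'; rewrite !cZ; lia.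
move=> hc.
have [|Y [r [lY hr E]]] := IH c lZ; first by lia.
have cZ d := count_ins r d Y; rewrite E /= in cZ.
exists (x :: Y), r; split => /=; last 2 first.
- exact: leqW.
- by rewrite E (negbTE n) ifN //; lia.
rewrite lY /=; case: x hx n hc => //= x hx n hc.
by case: (altP (c =P x)) hx hc => [<-|ncx]; rewrite !cZ; lia.
Qed.

(** The lattice condition puts a letter [x - 1] before each letter [x > 0] of [rev Y]. Hence the
    longest chain of [rev Y] has as many letters as the tableau has rows. *)
Lemma iota_subseq_latt (x : nat) (Y : seq nat) :
  latt Y -> x \in Y -> subseq (iota 0 x.+1) (rev Y).
Proof.
elim: Y x => //= z Y IH x /andP[lY hz].
rewrite inE rev_cons -cats1 => /orP[/eqP e|h]; last first.
  exact: subseq_trans (IH _ lY h) (prefix_subseq _ _).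
subst z; rewrite -/(iota 0 x.+1) -[x.+1]addn1 iotaD add0n; apply: cat_subseq => //.
case: x hz => [|x] hz; first exact: sub0seq.
apply: IH => //.
by rewrite -has_pred1 has_count; apply: leq_ltn_trans hz.
Qed.

Lemma lis_from_bounded (k lo : nat) (s : seq nat) :
  all (ltn^~ k) s -> lis_from lo s <= k - lo.
Proof.
elim: s lo => //= x s IH lo /andP[h1 h2].
by have := IH lo h2; have := IH x.+1 h2; case: ifP => ? ; lia.
Qed.

Lemma latt_lis (k : nat) (Y : seq nat) :
  latt Y -> (lis_from 0 (rev Y) <= k) = all (ltn^~ k) Y.
Proof.
move=> lY; apply/idP/idP => [h|h]; last first.
  by rewrite -(subn0 k) lis_from_bounded // all_rev.
apply/allP => x xY; apply: leq_trans h; apply/lis_fromP.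
exists (iota 0 x.+1); split; rewrite ?size_iota //.
- exact: iota_subseq_latt.
- exact: iota_ltn_sorted.
- by apply/allP.
Qed.

Fixpoint carry (c : nat) (s : seq nat) : nat :=
  if s is x :: s' then carry (if x == c then c.+1 else c) s' else c.

Lemma bumpw_cat (c : nat) (s u : seq nat) :
  bumpw c (s ++ u) = bumpw c s ++ bumpw (carry c s) u.
Proof. by elim: s c => //= x s IH c; case: ifP => _; rewrite /= IH. Qed.

Lemma carry_cat (c : nat) (s u : seq nat) :
  carry c (s ++ u) = carry (carry c s) u.
Proof. by elim: s c => //= x s IH c; rewrite IH. Qed.

Lemma size_bumpw (c : nat) (s : seq nat) : size (bumpw c s) = size s.
Proof. by elim: s c => //= x s IH c; case: ifP; rewrite /= IH. Qed.

Lemma take_bumpw (n c : nat) (s : seq nat) :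
  take n (bumpw c s) = bumpw c (take n s).
Proof.
elim: s n c => [|x s IH] [|n] c //; rewrite ?take0 ?drop0 //=.
by case: ifP; rewrite /= IH.
Qed.

Lemma drop_bumpw (n c : nat) (s : seq nat) :
  drop n (bumpw c s) = bumpw (carry c (take n s)) (drop n s).
Proof.
elim: s n c => [|x s IH] [|n] c //; rewrite ?take0 ?drop0 //=.
by case: ifP; rewrite /= IH.
Qed.

Lemma rev_ins (r : nat) (Y : seq nat) : r <= size Y ->
  rev (ins r Y).1 = take r (rev Y) ++ 0 :: bumpw 0 (drop r (rev Y)) /\
  (ins r Y).2 = carry 0 (drop r (rev Y)).
Proof.
elim: Y => [|x Y IH] //=; case: ifP => [/eqP-> _|n hr].
  have sz : (size Y).+1 = size (rev (x :: Y)) by rewrite size_rev.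
  by rewrite sz take_size drop_size /= [rev (0 :: _)]rev_cons -cats1.
have {}hr : r <= size Y by lia.
move: (IH hr); case: (ins r Y) => Z c /= [h1 h2].
have hr' : r <= size (rev Y) by rewrite size_rev.
rewrite rev_cons -cats1 take_cat drop_cat.
have -> : (if r < size (rev Y) then take r (rev Y)
    else rev Y ++ take (r - size (rev Y)) [:: x]) = take r (rev Y).
  case: ltnP => // h; have -> : r = size (rev Y) by lia.
  by rewrite subnn take_size cats0.
have -> : (if r < size (rev Y) then drop r (rev Y) ++ [:: x]
    else drop (r - size (rev Y)) [:: x]) = drop r (rev Y) ++ [:: x].
  case: ltnP => // h; have -> : r = size (rev Y) by lia.
  by rewrite subnn drop_size.
rewrite bumpw_cat carry_cat -h2 /=.
by case: ifP => _ /=; rewrite rev_cons h1 -cats1 -catA.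
Qed.

(** Exactly [size Y - r] entries exceed the inserted one, so it survives the deletion of the [n]
    largest entries when [n <= size Y - r]; [drop_ins_gt] is the other case. *)
Lemma drop_ins (n r : nat) (Y : seq nat) : r + n <= size Y ->
  drop n (ins r Y).1 = (ins r (drop n Y)).1.
Proof.
elim: Y n => [|x Y IH] [|n] h; rewrite ?drop0 //; first by rewrite addnS in h.
rewrite /= in h *; rewrite ifN; last by lia.
have := IH n; case: (ins r Y) => Z c /= <-; last by lia.
by case: ifP.
Qed.

Lemma drop_ins_gt (n r : nat) (Y : seq nat) : r <= size Y -> size Y < r + n ->
  drop n (ins r Y).1 = drop n.-1 Y.
Proof.
elim: Y n => [|x Y IH] [|n] //= hr h; rewrite ?addn0 in h; try lia.
case: ifP => // n1.
have := IH n; case: (ins r Y) => Z c /= IH'.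
have {}IH' : drop n Z = drop n.-1 Y by apply: IH'; lia.
case: n h IH' => [|n] h IH'; first by lia.
by case: ifP => _ /=; rewrite -IH'.
Qed.

(** The [drop] keeps the [r] entries smaller than the inserted one. The latter follows the smaller
    entries of row 0, and this row grows only if it has no larger entry to bump. *)
Lemma count0_ins (r : nat) (Y : seq nat) : r <= size Y ->
  count_mem 0 (ins r Y).1 =
  maxn (count_mem 0 Y) (count_mem 0 (drop (size Y - r) Y)).+1.
Proof.
elim: Y => [|x Y IH] //= hr; case: ifP => [/eqP->|n].
  by rewrite subnn /=; lia.
have {}hr : r <= size Y by lia.
have := count_ins r 0 Y; have := IH hr; rewrite subSn //=.
have : count_mem 0 (drop (size Y - r) Y) <= count_mem 0 Y.
  by rewrite -[X in _ <= count_mem 0 X](cat_take_drop (size Y - r)) count_cat leq_addl.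
case: (ins r Y) => Z c /=.
by case: (altP (x =P c)) => [->|n1] /=; lia.
Qed.

(** [B] lists the closers of the open arcs by decreasing opener, so an arc with [r] smaller open
    openers must have [r] entries behind it. *)
Definition insB (r v : nat) (B : seq nat) : seq nat :=
  take (size B - r) B ++ v :: drop (size B - r) B.

(* Schensted's theorem in a form stable under insertion: decreasing subsequences
   are controlled on all suffixes, increasing ones on all intervals. *)
Definition lis_compat (B Y : seq nat) : Prop :=
  [/\ size B = size Y,
      forall n, lis_from 0 (drop n B) = count_mem 0 (drop n Y) &
      forall a p, lis_from 0 (drop a (take p (rev B))) =
                  lis_from 0 (drop a (take p (rev Y)))].

Lemma lis_compat_behead (B Y : seq nat) :
  lis_compat B Y -> lis_compat (behead B) (behead Y).
Proof.
case=> h1 h2 h3; split; first by rewrite !size_behead h1.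
  by move=> n; rewrite -!drop1 !drop_drop h2.
have key (s : seq nat) p : take p (rev (behead s)) = take (minn p (size s).-1) (rev s).
  case: s => [|x s] //=.
  rewrite rev_cons -cats1 -[in RHS](size_rev s) take_cat.
  case: ltnP => h; first by congr take; lia.
  rewrite take_oversize; last by lia.
  have -> : minn p (size (rev s)) - size (rev s) = 0 by lia.
  by rewrite take0 cats0.
by move=> a p; rewrite !key h1 h3.
Qed.

Lemma size_insB (r v : nat) (B : seq nat) : size (insB r v B) = (size B).+1.
Proof. by rewrite /insB size_cat /= addnS -size_cat cat_take_drop. Qed.

Lemma interval_insert (T : Type) (z : T) (w u u' : seq T) (a p : nat) :
  size u = size u' ->
  drop a (take p (w ++ z :: u')) =
  if p <= size w then drop a (take p (w ++ u)) else
  if a <= size w then drop a w ++ z :: take (p - (size w).+1) u'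
  else drop (a - (size w).+1) (take (p - (size w).+1) u').
Proof.
move=> hu; rewrite !take_cat.
case: (ltngtP p (size w)) => [h|h|->] //=; last first.
  by rewrite subnn !take0.
have -> : p - size w = (p - (size w).+1).+1 by lia.
rewrite /= drop_cat; case: (ltngtP a (size w)) => [h'|h'|->] //=.
  by have -> : a - size w = (a - (size w).+1).+1 by lia.
by rewrite subnn drop_size.
Qed.

Lemma lis_compat_ins (r v : nat) (B Y : seq nat) :
  r <= size Y -> all (ltn v) B -> lis_compat B Y ->
  lis_compat (insB r v B) (ins r Y).1.
Proof.
move=> hr hv [h1 h2 h3]; split; first by rewrite size_insB size_ins h1.
  move=> n; rewrite /insB h1.
  set q := size Y - r.
  (* [q] is the index of [v] in the new list: a suffix either contains [v], which is a minimum by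
     [hv], or is already a suffix of [B]. *)
  have [hn|hn] := leqP n q.
    rewrite drop_ins; last by rewrite /q in hn; lia.
    rewrite count0_ins; last by rewrite size_drop /q in hn *; lia.
    rewrite drop_cat size_take h1.
    have -> : (if n < (if q < size Y then q else size Y)
       then drop n (take q B) ++ v :: drop q B
       else drop (n - (if q < size Y then q else size Y)) (v :: drop q B)) =
       drop n (take q B) ++ v :: drop q B.
      have -> : (if q < size Y then q else size Y) = q by rewrite /q; case: ltnP; lia.
      case: ltnP => // hn'; have -> : n = q by lia.
      by rewrite subnn drop0 [drop q (take q _)]drop_oversize // size_take_min geq_minl.
    rewrite lis_insert_min //; last 2 first.
    - by apply/allP => z /mem_drop/mem_take /(allP hv).
    - by apply/allP => z /mem_drop /(allP hv).
    rewrite h2; congr (maxn _ (_.+1)).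
      rewrite -h2; congr lis_from.
      rewrite -[in RHS](cat_take_drop q B) drop_cat size_take h1.
      have -> : (if q < size Y then q else size Y) = q by rewrite /q; case: ltnP; lia.
      case: ltnP => // hn'; have -> : n = q by lia.
      by rewrite subnn drop0 [drop q (take q _)]drop_oversize // size_take_min geq_minl.
    by rewrite drop_drop size_drop; congr (count_mem 0 (drop _ Y)); rewrite /q; lia.
  have e1 : drop n (take q B ++ v :: drop q B) = drop n.-1 B.
    rewrite drop_cat size_take h1.
    have -> : (if q < size Y then q else size Y) = q by rewrite /q; case: ltnP; lia.
    rewrite ltnNge (ltnW hn) /=.
    have -> : n - q = (n.-1 - q).+1 by lia.
    by rewrite /= drop_drop; congr drop; lia.
  by rewrite e1 h2 drop_ins_gt //; rewrite /q in hn; lia.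
have [e2 _] := rev_ins hr.
have eB : rev (insB r v B) = take r (rev B) ++ v :: drop r (rev B).
  rewrite /insB rev_cat rev_cons -cats1 -catA /= take_rev drop_rev.
  by rewrite h1.
move=> a p; rewrite eB e2.
rewrite (interval_insert v _ a p (erefl (size (drop r (rev B))))).
rewrite (interval_insert 0 _ a p (esym (size_bumpw 0 (drop r (rev Y))))).
have sB : size (take r (rev B)) = r by rewrite size_take size_rev h1; case: ltnP; lia.
have sY : size (take r (rev Y)) = r by rewrite size_take size_rev; case: ltnP; lia.
rewrite sB sY !cat_take_drop.
case: (leqP p r) => hp; first exact: h3.
have dt s : take (p - r.+1) (drop r s) = drop r (take p.-1 s) :> seq nat.
  by rewrite take_drop; congr (drop r (take _ s)); lia.
have hu z : z \in drop r (take p.-1 (rev B)) -> v < z.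
  by move=> /mem_drop/mem_take; rewrite mem_rev => /(allP hv).
(* On an interval that contains the insertion point, [lis_insert_min] for [B] and [lis_insert_bump]
   for [Y] give the same formula. *)
case: (leqP a r) => ha.
  rewrite take_bumpw !dt lis_insert_bump lis_insert_min //; last 2 first.
  - by apply/allP => z /mem_drop/mem_take; rewrite mem_rev => /(allP hv).
  - by apply/allP => z /hu.
  have cat_int s : size s = size Y ->
      drop a (take r s) ++ drop r (take p.-1 s) = drop a (take p.-1 s) :> seq nat.
    move=> hs; rewrite -[in RHS](cat_take_drop r (take p.-1 s)) drop_cat.
    rewrite -take_min (minn_idPl _); last by lia.
    rewrite size_take hs; have -> : (if r < size Y then r else size Y) = r by case: ltnP; lia.
    case: ltnP => // hra; have -> : a = r by lia.
    by rewrite subnn drop0 [drop r (take r _)]drop_oversize // size_take_min geq_minl.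
  by rewrite !cat_int ?size_rev // !h3 subn0.
(* Beyond the insertion point only the bumping path acts, and at threshold 0 [lis_bump] leaves the
   longest chain unchanged. *)
rewrite take_bumpw drop_bumpw lis_bump !sub0n subn0 !dt.
rewrite (maxn_idPl (lis_from_anti _ (leq0n _))).
by rewrite !drop_drop !h3.
Qed.

(** * Matchings and their codes *)

Definition fpf_inv (N : nat) (s : nat -> nat) : Prop :=
  forall a, a < N -> [/\ s a < N, s (s a) = a & s a != a].

Definition openers (s : nat -> nat) (i : nat) : seq nat :=
  [seq a <- iota 0 i | i <= s a].

Definition opens (s : nat -> nat) (i : nat) : seq nat :=
  rev [seq s a | a <- openers s i].

(* The arcs of a matching are given by its fixed-point free involution [s].  Its
   points are read from the last to the first: an opener is coded by [None], a
   closer by [Some r] where [r] counts the smaller openers of the arcs above it. *)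
Fixpoint code (s : nat -> nat) (i : nat) : seq (option nat) :=
  if i is i'.+1 then
    (if i' < s i' then None
     else Some (count (fun a => i' < s a) (iota 0 (s i')))) :: code s i'
  else [::].

Fixpoint valid (h : nat) (e : seq (option nat)) : bool :=
  match e with
  | [::] => h == 0
  | None :: e' => (0 < h) && valid h.-1 e'
  | Some r :: e' => (r <= h) && valid h.+1 e'
  end.

Definition inbox (k j : nat) (Y : seq nat) : bool :=
  all (ltn^~ k) Y && (count_mem 0 Y <= j).

Fixpoint good (k j : nat) (Y : seq nat) (e : seq (option nat)) : bool :=
  inbox k j Y &&
  match e with
  | [::] => true
  | None :: e' => good k j (behead Y) e'
  | Some r :: e' => good k j (ins r Y).1 e'
  end.

Section codes_of_involutions.
Variables (N : nat) (s : nat -> nat).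
Hypothesis hs : fpf_inv N s.

Lemma opens_open (i : nat) : i < N -> i < s i -> opens s i.+1 = s i :: opens s i.
Proof.
move=> hi hsi; rewrite /opens /openers -addn1 iotaD add0n filter_cat map_cat rev_cat /=.
rewrite addn1 hsi /=; congr (_ :: rev (map _ _)).
apply: eq_in_filter => a; rewrite mem_iota /= add0n => ha.
have [_ h2 _] := hs (ltn_trans ha hi).
by case: (ltngtP i (s a)) => // e; move: h2; rewrite -e; lia.
Qed.

Lemma rev_insB (r v : nat) (B : seq nat) :
  rev (insB r v B) = take r (rev B) ++ v :: drop r (rev B).
Proof. by rewrite /insB rev_cat rev_cons -cats1 -catA /= take_rev drop_rev. Qed.

Lemma opens_close (i : nat) : i < N -> s i < i ->
  let r := count (fun a => i < s a) (iota 0 (s i)) in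
  opens s i = insB r i (opens s i.+1) /\ r <= size (opens s i.+1).
Proof.
move=> hi hsi r; have [_ h2 _] := hs hi.
have part (p : pred nat) : [seq a <- iota 0 i | p a] =
   [seq a <- iota 0 (s i) | p a] ++ (if p (s i) then [:: s i] else [::]) ++
   [seq a <- iota (s i).+1 (i - (s i).+1) | p a].
  have {1}-> : i = s i + (1 + (i - (s i).+1)) by lia.
  rewrite iotaD filter_cat add0n iotaD filter_cat /= addn1.
  by congr (_ ++ (_ ++ _)); case: ifP.
have ne a : a < i -> a != s i -> (i <= s a) = (i < s a).
  move=> ha na; case: (ltngtP i (s a)) => // e.
  by have [_ h _] := hs (ltn_trans ha hi); move: na; rewrite e h eqxx.
have e1 : openers s i.+1 = [seq a <- iota 0 i | i < s a].
  rewrite /openers -addn1 iotaD add0n filter_cat /= addn1.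
  by rewrite ltnNge (ltnW hsi) /= cats0.
have sz : size [seq a <- iota 0 (s i) | i < s a] = r by rewrite size_filter.
have e2 : openers s i.+1 = [seq a <- iota 0 (s i) | i < s a] ++
    [seq a <- iota (s i).+1 (i - (s i).+1) | i < s a].
  by rewrite e1 part h2 ltnn.
split; last first.
  by rewrite /opens size_rev size_map e2 size_cat sz leq_addr.
apply: (can_inj revK); rewrite rev_insB /opens !revK e2 map_cat.
rewrite take_size_cat ?size_map // drop_size_cat ?size_map //.
rewrite /openers part h2 leqnn /= map_cat /= h2.
congr (_ ++ _ :: _); congr map; apply: eq_in_filter => a; rewrite mem_iota => ha;
  apply: ne; lia.
Qed.

Lemma opens_gt (i : nat) : all (ltn i) (opens s i.+1).
Proof.
rewrite /opens all_rev; apply/allP => b /mapP[a].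
by rewrite mem_filter => /andP[h _] ->.
Qed.

Lemma code_valid (i : nat) : i <= N -> valid (size (opens s i)) (code s i).
Proof.
elim: i => [|i IH] hi; first by [].
rewrite /=; case: ltngtP => h.
- by rewrite opens_open //= IH // ltnW.
- have [e1 e2] := opens_close hi h.
  by rewrite e2 /=; move: (IH (ltnW hi)); rewrite e1 size_insB.
- by have [_ _] := hs hi; rewrite -h eqxx.
Qed.

Lemma opensN : opens s N = [::].
Proof.
rewrite /opens /openers; suff -> : [seq a <- iota 0 N | N <= s a] = [::] by [].
apply/eqP; rewrite -[_ == _]negbK -has_filter; apply/hasPn => a.
by rewrite mem_iota /= -ltnNge => /hs[].
Qed.

Lemma inbox_compat (k j : nat) (B Y : seq nat) : lis_compat B Y -> latt Y ->
  inbox k j Y = (lis_from 0 (rev B) <= k) && (lis_from 0 B <= j).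
Proof.
case=> h1 h2 h3 lY; rewrite /inbox -latt_lis //.
have := h2 0; rewrite !drop0 => ->.
have := h3 0 (size B); rewrite !drop0 !take_oversize ?size_rev // => [->//|].
by rewrite h1.
Qed.

Lemma good_code (k j i : nat) (Y : seq nat) : i <= N ->
  lis_compat (opens s i) Y -> latt Y ->
  good k j Y (code s i) =
  all (fun i' => (lis_from 0 (rev (opens s i')) <= k) &&
                 (lis_from 0 (opens s i') <= j)) (iota 0 i.+1).
Proof.
elim: i Y => [|i IH] Y hi hY lY.
  by rewrite [good _ _ _ _]/= (inbox_compat k j hY lY).
rewrite -[X in iota 0 X]addn1 iotaD all_cat add0n /= andbT andbC.
rewrite (inbox_compat k j hY lY); congr (_ && _).
case: ltngtP => h.
- have := opens_open hi h => e.
  have hY' := lis_compat_behead hY; rewrite e /= in hY'.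
  rewrite (IH _ (ltnW hi) hY') //; case: (Y) lY => //= x Y' /andP[] //.
- have [e1 e2] := opens_close hi h.
  rewrite (IH _ (ltnW hi)) //; last exact: latt_ins.
  rewrite e1; apply: lis_compat_ins => //; last exact: opens_gt.
  by case: hY => <-.
- by have [_ _] := hs hi; rewrite -h eqxx.
Qed.

End codes_of_involutions.

(** * Decoding: the arcs recovered from a code *)

Fixpoint pairs (B : seq nat) (e : seq (option nat)) : seq (nat * nat) :=
  match e with
  | [::] => [::]
  | None :: e' => (size e', head 0 B) :: pairs (behead B) e'
  | Some r :: e' => pairs (insB r (size e') B) e'
  end.

Lemma perm_insB (r v : nat) (B : seq nat) : perm_eq (insB r v B) (v :: B).
Proof.
by rewrite /insB perm_catC /= perm_cons perm_catC cat_take_drop.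
Qed.

Lemma size_code (s : nat -> nat) (i : nat) : size (code s i) = i.
Proof. by elim: i => //= i ->. Qed.

Lemma pairs_code (N : nat) (s : nat -> nat) (i : nat) : fpf_inv N s -> i <= N ->
  pairs (opens s i) (code s i) = [seq (a, s a) | a <- rev (iota 0 i) & a < s a].
Proof.
move=> hs; elim: i => [|i IH] hi //.
rewrite -[X in iota 0 X]addn1 iotaD rev_cat add0n /= size_code.
case: ltngtP => h.
- by rewrite (opens_open hs hi h) /= IH // ltnW.
- by have [<- _] := opens_close hs hi h; rewrite IH // ltnW.
- by have [_ _] := hs _ hi; rewrite -h eqxx.
Qed.

Lemma count_iotaS (p : pred nat) (n : nat) :
  count p (iota 0 n.+1) = count p (iota 0 n) + p n.
Proof. by rewrite -addn1 iotaD count_cat /= addn0. Qed.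

(** For [B = [::]] this says that the decoded arcs use every point exactly once, so that they form a
    matching. *)
Lemma pairs_perm (B : seq nat) (e : seq (option nat)) : valid (size B) e ->
  perm_eq (unzip1 (pairs B e) ++ unzip2 (pairs B e)) (B ++ iota 0 (size e)).
Proof.
elim: e B => [|[r|] e IH] B /=.
- by move=> /eqP/size0nil->.
- case/andP=> hr hv; have := IH (insB r (size e) B); rewrite size_insB => /(_ hv) h.
  apply/seq.permP => p; rewrite (seq.permP h) count_cat (seq.permP (perm_insB _ _ _)).
  by rewrite count_cat -/(iota 0 (size e).+1) count_iotaS [count p (_ :: _)]/= -addnA addnC -addnA.
case: B => // x B hv; apply/seq.permP => p; have := seq.permP (IH _ hv) p.
rewrite !count_cat -/(iota 0 (size e).+1) count_iotaS /= !count_cat /= => IHp.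
move: (count p (unzip1 _)) (count p (unzip2 _)) (count p B) IHp => a b c.
by move: (count p _) (nat_of_bool (p x)) (nat_of_bool (p (size e))) => d f g; lia.
Qed.

Lemma pairs_lt (B : seq nat) (e : seq (option nat)) (q : nat * nat) :
  valid (size B) e -> all (leq (size e)) B -> q \in pairs B e ->
  q.1 < q.2 /\ q.1 < size e.
Proof.
elim: e B => [|[r|] e IH] B //=.
  case/andP=> hr hv hB hq.
  have [||h1 h2] := IH (insB r (size e) B) _ _ hq.
  - by rewrite size_insB.
  - rewrite (perm_all _ (perm_insB _ _ _)) /= leqnn /=.
    by apply: sub_all hB => x; apply: ltnW.
  - by split => //; lia.
case: B => //= x B hv /andP[hx hB]; rewrite inE => /orP[/eqP->//|hq].
have [|h1 h2] := IH B hv _ hq; last by split => //; lia.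
by apply: sub_all hB => y; apply: ltnW.
Qed.

Lemma insB_inj (r r' v : nat) (B B' : seq nat) :
  r <= size B -> r' <= size B' -> v \notin B -> v \notin B' ->
  insB r v B = insB r' v B' -> r = r' /\ B = B'.
Proof.
move=> hr hr' hv hv' E.
have eS : size B = size B' by apply: succn_inj; rewrite -(size_insB r v) -(size_insB r' v) E.
have ind r0 (B0 : seq nat) : r0 <= size B0 -> v \notin B0 -> index v (insB r0 v B0) = size B0 - r0.
  move=> h h'; rewrite /insB index_cat ifN; last by apply: contra h' => /mem_take.
  by rewrite /= eqxx addn0 size_take; case: ltnP; lia.
have er : r = r'.
  have := ind _ _ hr hv; have := ind _ _ hr' hv'; rewrite -E => ->; lia.
split => //.
have remB r0 (B0 : seq nat) : v \notin B0 -> rem v (insB r0 v B0) = B0.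
  move=> h; rewrite /insB; set q := size B0 - r0.
  rewrite -[RHS](cat_take_drop q B0).
  have : v \notin take q B0 by apply: contra h => /mem_take.
  elim: (take q B0) => [|x s IH] /=; first by rewrite eqxx.
  by rewrite inE negb_or eq_sym => /andP[/negbTE-> /IH->].
by rewrite -(remB r B) // E remB.
Qed.

(** Used for surjectivity of the coding. The list of open arcs is part of the conclusion because, by
    [insB_inj], it is what determines the index [r] at each closer. *)
Lemma code_pairs (N : nat) (s : nat -> nat) (B : seq nat) (e : seq (option nat)) :
  fpf_inv N s -> size e <= N -> valid (size B) e -> all (leq (size e)) B ->
  (forall q, q \in pairs B e -> s q.1 = q.2 /\ s q.2 = q.1) ->
  opens s (size e) = B /\ code s (size e) = e.
Proof.
move=> hs; elim: e B => [|[r|] e IH] B /=.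
- by move=> _ /eqP/size0nil->.
- move=> hN /andP[hr hv] hB hq.
  have [||h1 h2] := IH (insB r (size e) B) (ltnW hN) _ _ hq.
  + by rewrite size_insB.
  + rewrite (perm_all _ (perm_insB _ _ _)) /= leqnn /=.
    by apply: sub_all hB => x; apply: ltnW.
  have hse : s (size e) < size e.
    have : size e \in opens s (size e).
      by rewrite h1 (perm_mem (perm_insB _ _ _)) mem_head.
    rewrite /opens mem_rev => /mapP[a]; rewrite mem_filter mem_iota /= add0n.
    move=> /andP[_ ha] e0; have [_ h _] := hs _ (ltn_trans ha hN).
    by rewrite {1}e0 h.
  have [e1 e2] := opens_close hs hN hse.
  have nin : size e \notin opens s (size e).+1.
    by apply/negP => /(allP (opens_gt s (size e))) /=; rewrite ltnn.
  have nin' : size e \notin B by apply/negP => /(allP hB); rewrite ltnn.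
  have [er eB] := insB_inj e2 hr nin nin' (etrans (esym e1) h1).
  by rewrite ltnNge (ltnW hse) /= h2 er.
case: B => //= x B hN hv /andP[hx hB] hq.
have [||h1 h2] := IH B (ltnW hN) hv.
- by apply: sub_all hB => y; apply: ltnW.
- by move=> q hq'; apply: hq; rewrite inE hq' orbT.
have [e1 _] := hq (size e, x) (mem_head _ _); rewrite /= in e1.
have hse : size e < s (size e) by rewrite e1.
by rewrite hse h2 (opens_open hs hN hse) e1 h1.
Qed.

(** * Enumeration of the valid codes *)

Fixpoint codes (n h : nat) : seq (seq (option nat)) :=
  if n is n'.+1 then
    (if h is h'.+1 then [seq None :: e | e <- codes n' h'] else [::]) ++
    [seq Some r :: e | r <- iota 0 h.+1, e <- codes n' h.+1]
  else if h is 0 then [:: [::]] else [::].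

Lemma codesS (n h : nat) : codes n.+1 h =
  (if h is h'.+1 then [seq None :: e | e <- codes n h'] else [::]) ++
    [seq Some r :: e | r <- iota 0 h.+1, e <- codes n h.+1].
Proof. by []. Qed.

Lemma mem_codes (n h : nat) (e : seq (option nat)) :
  (e \in codes n h) = (size e == n) && valid h e.
Proof.
elim: n h e => [|n IH] h e.
  by case: h e => [|h] [|[r|] e].
rewrite codesS mem_cat.
apply/orP/andP.
  case.
    case: h => // h /mapP[e' ]; rewrite IH => /andP[/eqP h1 h2] -> /=.
    by rewrite h1 eqxx.
  move=> /allpairsP[[r e'] [hr he ->]]; rewrite mem_iota in hr.
  move: he => /=; rewrite IH => /andP[/eqP h1 h2].
  by rewrite h1 eqxx h2 andbT; split => //; move: hr => /=; lia.
case: e => [|[r|] e] [] // /eqP[h1]; rewrite [valid _ _]/=.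
  move=> /andP[h2 h3]; right; apply/allpairsP; exists (r, e); split => //.
    by rewrite mem_iota [(r, e).1]/=; lia.
  by rewrite IH h1 eqxx.
case: h => // h h2; left; apply/mapP; exists e => //.
by rewrite IH h1 eqxx.
Qed.

Lemma codes_uniq (n h : nat) : uniq (codes n h).
Proof.
elim: n h => [|n IH] h; first by case: h.
have U : uniq [seq Some r :: e | r <- iota 0 h.+1, e <- codes n h.+1].
  apply: allpairs_uniq; rewrite ?iota_uniq //.
  by move=> [r e] [r' e'] _ _ /= [-> ->].
rewrite codesS cat_uniq U andbT; case: h {U} => [|h]; first by rewrite /= -all_predC all_predT.
rewrite map_inj_uniq ?IH => [|e e' []] //.
by apply/hasPn => e /allpairsP[[r e'] [_ _ ->]]; apply/mapP => -[].
Qed.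

(** This is [(n - 1)!!] for even [n] and 0 for odd [n], the number of perfect matchings of [n]
    points. *)
Fixpoint dfact (n : nat) : nat :=
  if n is n'.+2 then n'.+1 * dfact n' else (n == 0).

(** Among the [n] points still to be read, choose the [h] openers of the arcs already open; the
    remaining points are matched among themselves. *)
Lemma size_codes (n h : nat) : size (codes n h) = 'C(n, h) * dfact (n - h).
Proof.
elim: n h => [|n IH] h; first by case: h => //= h; rewrite bin0n.
rewrite codesS size_cat size_allpairs IH size_iota.
case: h => [|h].
  by rewrite bin0 bin1 !mul1n subn0 add0n; case: n {IH} => // n; rewrite subn1.
rewrite size_map IH binS mulnDl addnC subSS; congr (_ + _).
case: (ltnP n h.+2) => hn; last first.
  have -> : n - h = (n - h.+2).+2 by lia.
  rewrite [dfact _.+2]/= mulnA mul_bin_left mulnA; congr (_ * _).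
  by rewrite mulnC; congr (_ * _); lia.
rewrite bin_small // !(mul0n, muln0).
case: (ltngtP n h.+1) => [h1|h1|->]; [by rewrite bin_small|lia|].
by rewrite subSnn muln0.
Qed.

Lemma dfact_fact (n : nat) : dfact n.*2 * (2 ^ n * n`!) = (n.*2)`!.
Proof.
elim: n => // n IH; rewrite doubleS [dfact _]/= [RHS]factS [in RHS]factS -IH expnS factS -!mul2n.
by ring.
Qed.

(** * Matchings as fixed-point free involutions *)

Lemma is_matchingP (n : nat) (M : {set 'I_n.*2 * 'I_n.*2}) :
  reflect [/\ forall p, p \in M -> p.1 < p.2,
              forall v : 'I_n.*2, exists2 p, p \in M & v \in [set p.1; p.2] &
              forall p q (v : 'I_n.*2), p \in M -> q \in M ->
                v \in [set p.1; p.2] -> v \in [set q.1; q.2] -> p = q]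
          (is_matching M).
Proof.
apply: (iffP andP) => [[/'forall_implyP h1 /and3P[/eqP h2 /finset.trivIsetP h3 h4]]|[h1 h2 h3]].
  split=> // [v|p q v hp hq hvp hvq].
    have : v \in finset.cover [set [set p.1; p.2] | p in M] by rewrite h2 inE.
    by case/finset.bigcupP => _ /imsetP[p hp ->]; exists p.
  (* Disjointness of blocks only identifies the unordered pairs; [p.1 < p.2] and [q.1 < q.2] then
     fix the order. *)
  have : [set p.1; p.2] = [set q.1; q.2].
    apply/eqP/negPn/negP => /(h3 _ _ (imset_f _ hp) (imset_f _ hq)).
    by move=> /pred0P/(_ v) /=; rewrite hvp hvq.
  have := h1 _ hp; have := h1 _ hq.
  case: p q {hp hq hvp hvq} => [a b] [c d] /= cd ab /setP E.
  have := E a; have := E b; rewrite !inE !eqxx orbT /= => /esym hb /esym ha.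
  have neq (x y : 'I_n.*2) : x < y -> (x == y) = false by move=> h; apply/eqP => e; move: h; rewrite e ltnn.
  case/orP: ha => /eqP ea; case/orP: hb => /eqP eb; subst => //.
  - by rewrite ltnn in ab.
  - by move: (ltn_trans ab cd); rewrite ltnn.
  - by rewrite ltnn in ab.
split; first by apply/'forall_implyP.
apply/and3P; split.
- apply/eqP/setP => v; rewrite inE; have [p hp hv] := h2 v.
  by apply/finset.bigcupP; exists [set p.1; p.2] => //; apply: imset_f.
- apply/finset.trivIsetP => _ _ /imsetP[p hp ->] /imsetP[q hq ->] hpq.
  apply/pred0P => v /=; apply/negP => /andP[hvp hvq].
  by move: hpq; rewrite (h3 p q v) ?eqxx.
- by apply/imsetP => -[p hp /setP/(_ p.1)]; rewrite !inE eqxx.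
Qed.

Definition partner (n : nat) (M : {set 'I_n.*2 * 'I_n.*2}) (a : nat) : nat :=
  if [pick p in M | val p.1 == a] is Some p then val p.2 else
  if [pick p in M | val p.2 == a] is Some p then val p.1 else a.

Section partner_of_matching.
Variables (n : nat) (M : {set 'I_n.*2 * 'I_n.*2}).
Hypothesis hM : is_matching M.

Lemma partner_mem (p : 'I_n.*2 * 'I_n.*2) : p \in M ->
  partner M (val p.1) = val p.2 /\ partner M (val p.2) = val p.1.
Proof.
case/is_matchingP: hM => h1 h2 h3 hp; rewrite /partner.
have uq q v : q \in M -> v \in [set p.1; p.2] -> v \in [set q.1; q.2] -> p = q.
  by move=> hq; apply: h3.
split.
  case: pickP => [q /andP[hq /eqP/val_inj e]|/(_ p)]; last by rewrite hp eqxx.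
  by rewrite (uq q p.1) ?inE ?e ?eqxx.
case: pickP => [q /andP[hq /eqP/val_inj e]|_].
  have e' : p = q by apply: (uq q p.2); rewrite ?inE ?e ?eqxx ?orbT.
  by have := h1 _ hp; rewrite -[in X in X -> _]e e' ltnn.
case: pickP => [q /andP[hq /eqP/val_inj e]|/(_ p)]; last by rewrite hp eqxx.
by rewrite (uq q p.2) ?inE ?e ?eqxx ?orbT.
Qed.

Lemma partner_cases (a : nat) : a < n.*2 ->
  exists2 p, p \in M & (a = val p.1 \/ a = val p.2).
Proof.
case/is_matchingP: hM => h1 h2 h3 ha; have [p hp] := h2 (Ordinal ha).
by rewrite !inE => /orP[]/eqP/(congr1 val)/= e; exists p => //; [left|right].
Qed.

Lemma partner_inv : fpf_inv n.*2 (partner M).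
Proof.
move=> a ha; have [p hp] := partner_cases ha.
have [e1 e2] := partner_mem hp.
case/is_matchingP: (hM) => /(_ _ hp) lt _ _.
case=> ->; first by rewrite e1 e2 ltn_ord neq_ltn lt orbT.
by rewrite e2 e1 ltn_ord neq_ltn lt.
Qed.

Lemma partner_lt (a b : nat) : a < n.*2 -> a < partner M a -> b = partner M a ->
  exists2 p, p \in M & (a = val p.1 /\ b = val p.2).
Proof.
move=> ha lt ->; have [p hp] := partner_cases ha.
have [e1 e2] := partner_mem hp.
case/is_matchingP: (hM) => /(_ _ hp) lt' _ _.
case=> e; exists p => //; subst a; first by rewrite e1.
by rewrite e2 in lt; have := ltn_trans lt lt'; rewrite ltnn.
Qed.

End partner_of_matching.

Lemma lift_pairs (N : nat) (l : seq (nat * nat)) :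
  (forall q, q \in l -> q.1 < N /\ q.2 < N) ->
  exists s : seq ('I_N * 'I_N), l = [seq (val p.1, val p.2) | p <- s].
Proof.
elim: l => [|[a b] l IH] h; first by exists [::].
have [|s ->] := IH; first by move=> q hq; apply: h; rewrite inE hq orbT.
have [/= ha hb] := h (a, b) (mem_head _ _).
by exists ((Ordinal ha, Ordinal hb) :: s).
Qed.

Lemma map_uniq_inj (T1 T2 : eqType) (g : T1 -> T2) (t : seq T1) :
  uniq [seq g x | x <- t] -> {in t &, injective g}.
Proof.
elim: t => //= x t IH /andP[hx ht] y z; rewrite !inE.
case/orP=> [/eqP->|hy]; case/orP=> [/eqP->|hz] // e; last exact: IH.
- by case/negP: hx; rewrite e map_f.
- by case/negP: hx; rewrite -e map_f.
Qed.

Section chains.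
Variables (n : nat) (M : {set 'I_n.*2 * 'I_n.*2}).
Hypothesis hM : is_matching M.
Let s := partner M.

(* [f] is [id] for crossings and [rev] for nestings *)
Lemma chain_opens (f : seq nat -> seq nat) (r : nat) :
  (f = id \/ f = rev) ->
  (exists i, i <= n.*2 /\ r <= lis_from 0 (f [seq s a | a <- openers s i])) <->
  (exists S : {set 'I_n.*2 * 'I_n.*2}, [/\ S \subset M, #|S| = r &
    [exists t : r.-tuple ('I_n.*2 * 'I_n.*2), (S == [set p in t]) &&
      sorted ltn ([seq val p.1 | p <- t] ++ f [seq val p.2 | p <- t])]]).
Proof.
move=> hf.
have fK l : f (f l) = l by case: hf => -> //; rewrite revK.
have fsub l l' : subseq l l' -> subseq (f l) (f l') by case: hf => -> //; rewrite subseq_rev.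
have fsz l : size (f l) = size l by case: hf => -> //; rewrite size_rev.
have fmem l : f l =i l by case: hf => -> // x; rewrite mem_rev.
have hs := partner_inv hM; rewrite -/s in hs.
have ltnT : transitive ltn := ltn_trans.
have Osort i : sorted ltn (openers s i).
  by apply: sorted_filter => //; apply: iota_ltn_sorted.
split.
  case=> i [hi /lis_fromP[s' [h1 h2 _ h3]]].
  have := fsub _ _ h1; rewrite fK => /subseqP[m hm].
  rewrite -map_mask; set A := mask m (openers s i) => eA.
  have Asub : subseq A (openers s i) by apply: mask_subseq.
  have hA a : a \in A -> a < i /\ i <= s a.
    by move=> /(mem_subseq Asub); rewrite mem_filter mem_iota /= add0n => /andP[].
  have Asort : sorted ltn A by apply: subseq_sorted Asub (Osort i).
  have [q|t et] := @lift_pairs n.*2 [seq (a, s a) | a <- A].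
    move=> /mapP[a /hA[ha1 ha2] ->] /=.
    have ha := leq_trans ha1 hi.
    by split => //; case: (hs a ha).
  have e1 : [seq val p.1 | p <- t] = A.
    by have := congr1 (map fst) et; rewrite -!map_comp map_id_in // => ->.
  have e2 : [seq val p.2 | p <- t] = f s'.
    by have := congr1 (map snd) et; rewrite -!map_comp => <-; rewrite eA.
  have szt : size t == r by rewrite -h3 -(fsz s') -e2 size_map.
  have ut : uniq t.
    apply: (@map_uniq _ _ (fun p => val p.1)); rewrite e1.
    by move: Asort; rewrite ltn_sorted_uniq_leq => /andP[].
  exists [set p in t]; split.
  - apply/fintype.subsetP => p; rewrite inE => hp.
    have : (val p.1, val p.2) \in [seq (a, s a) | a <- A].
      by rewrite et; apply/mapP; exists p.
    case/mapP => a /hA[ha1 ha2] [ea eb].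
    have [||q hq [ea' eb']] := @partner_lt n M hM a (s a) _ _ erefl.
    + exact: leq_trans ha1 hi.
    + exact: leq_trans ha1 ha2.
    suff -> : p = q by [].
    case: (p) (q) ea eb ea' eb' => [x y] [z w] /= e3 e4 e5 e6.
    by congr (_, _); apply: val_inj => /=; congruence.
  - by rewrite cardsE (card_uniqP ut) (eqP szt).
  - apply/existsP; exists (Tuple szt); rewrite eqxx /= e1 e2 fK.
    rewrite (sorted_pairwise ltnT) pairwise_cat -!(sorted_pairwise ltnT) Asort h2 !andbT.
    apply/allrelP => a b /hA[ha1 ha2] hb; apply: leq_trans ha1 _.
    have : b \in f s' by rewrite fmem.
    by rewrite eA => /mapP[a' /hA[_ h] ->].
case=> S [hS hr /existsP[t /andP[/eqP eS]]].
have ht p : p \in t -> [/\ p \in M, s (val p.1) = val p.2 & p.1 < p.2].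
  move=> hp; have hp' : p \in M by apply: (fintype.subsetP hS); rewrite eS inE.
  have [e1 e2] := partner_mem hM hp'; split => //.
  by case/is_matchingP: hM => /(_ _ hp').
set A := [seq val p.1 | p <- t]; set B := [seq val p.2 | p <- t].
have eB : B = [seq s a | a <- A].
  by rewrite /A /B -map_comp; apply/eq_in_map => p /ht[_ h _] /=; rewrite -h.
rewrite (sorted_pairwise ltnT) pairwise_cat -!(sorted_pairwise ltnT) => /and3P[/allrelP hAB sA sB].
case: (posnP r) => [->|r0]; first by exists 0.
have szB : size (f B) = r by rewrite fsz size_map size_tuple.
(* [f B] is increasing, so its head [i] is the smallest closer of the chain: at the cut [i] all arcs
   of the chain are open. *)
case efB : (f B) szB => [|i l] szB; first by rewrite -szB in r0.
have iB : i \in f B by rewrite efB mem_head.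
have hi : i <= n.*2.
  by move: iB; rewrite fmem => /mapP[p _ ->]; apply: ltnW; apply: ltn_ord.
exists i; split => //.
apply/lis_fromP; exists (f B); split; [|by []|by apply/allP|by rewrite efB].
apply: fsub; rewrite eB; apply: map_subseq.
have -> : A = [seq a <- openers s i | a \in A]; last exact: filter_subseq.
apply: (irr_sorted_eq ltnT ltnn) => //; first exact: sorted_filter.
move=> a; rewrite mem_filter /=; case: (boolP (a \in A)) => //= aA.
have hai : a < i := hAB _ _ aA iB.
rewrite mem_filter mem_iota /= add0n hai andbT; apply/esym.
have : s a \in f B by rewrite fmem eB map_f.
rewrite efB inE => /orP[/eqP->|hl]; first by rewrite leqnn.
apply: ltnW.
by move: sB; rewrite efB /= path_sortedE // => /andP[/allP/(_ _ hl)].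
Qed.

End chains.

(** By [chain_opens] a bound on crossings or nestings is a bound at every cut, and there [good_code]
    reads it off the tableau. *)
Lemma cr_ne_code (n k j : nat) (M : matching n) :
  (cr M <= k) && (ne M <= j) = good k j [::] (code (partner (val M)) n.*2).
Proof.
have hM : is_matching (val M) := valP M.
have hs := partner_inv hM; set s := partner (val M) in hs *.
rewrite (good_code hs k j (leqnn _)) //; last first.
  by rewrite (opensN hs); split.
apply/andP/allP => [[hc hn] i|h].
  rewrite mem_iota /= add0n ltnS => hi; rewrite /opens revK.
  move/bigmax_leqP: hc => hc; move/bigmax_leqP: hn => hn.
  apply/andP; split.
    have [S [h1 h2 h3]] := (chain_opens hM _ (or_introl (erefl id))).1
      (ex_intro _ i (conj hi (leqnn _))).
    by rewrite -h2; apply: hc; rewrite h1 /is_crossing h2.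
  have [S [h1 h2 h3]] := (chain_opens hM _ (or_intror (erefl rev))).1
    (ex_intro _ i (conj hi (leqnn _))).
  by rewrite -h2; apply: hn; rewrite h1 /is_nesting h2.
split; apply/bigmax_leqP => S /andP[h1 h2].
  have [i [hi hl]] := (chain_opens hM #|S| (or_introl (erefl id))).2
    (ex_intro _ S (And3 h1 erefl h2)).
  apply: leq_trans hl _; have := h i.
  by rewrite mem_iota /= add0n ltnS /opens revK => /(_ hi)/andP[].
have [i [hi hl]] := (chain_opens hM #|S| (or_intror (erefl rev))).2
  (ex_intro _ S (And3 h1 erefl h2)).
apply: leq_trans hl _; have := h i.
by rewrite mem_iota /= add0n ltnS /opens revK => /(_ hi)/andP[].
Qed.

Lemma partner_code_inj (n : nat) (M M' : {set 'I_n.*2 * 'I_n.*2}) :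
  is_matching M -> is_matching M' ->
  code (partner M) n.*2 = code (partner M') n.*2 -> M = M'.
Proof.
move=> hM hM' E.
have key (M1 : {set 'I_n.*2 * 'I_n.*2}) p : is_matching M1 ->
    (p \in M1) = ((val p.1, val p.2) \in pairs [::] (code (partner M1) n.*2)).
  move=> h1; have hs := partner_inv h1.
  rewrite -(opensN hs) (pairs_code hs (leqnn _)).
  apply/idP/mapP => [hp|[a]].
    have [e1 e2] := partner_mem h1 hp; exists (val p.1); last by rewrite e1.
    rewrite mem_filter mem_rev mem_iota /= add0n ltn_ord e1 andbT.
    by case/is_matchingP: h1 => /(_ _ hp).
  rewrite mem_filter mem_rev mem_iota /= add0n => /andP[h2 h3] [e1 e2].
  have [q hq [e3 e4]] := partner_lt h1 h3 h2 erefl.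
  suff -> : p = q by [].
  case: (p) (q) e1 e2 e3 e4 => [x y] [z w] /= e3 e4 e5 e6.
  by congr (_, _); apply: val_inj => /=; congruence.
by apply/setP => p; rewrite !key // E.
Qed.

Lemma partner_code_surj (n : nat) (e : seq (option nat)) :
  e \in codes n.*2 0 ->
  exists2 M : {set 'I_n.*2 * 'I_n.*2}, is_matching M & code (partner M) n.*2 = e.
Proof.
rewrite mem_codes => /andP[/eqP sz hv0].
have hv : valid (size ([::] : seq nat)) e by [].
have hlt q : q \in pairs [::] e -> q.1 < q.2 /\ q.2 < n.*2.
  move=> hq; have [h1 h2] := pairs_lt hv isT hq; split => //.
  have : q.2 \in unzip1 (pairs [::] e) ++ unzip2 (pairs [::] e).
    by rewrite mem_cat (map_f snd hq) orbT.
  by rewrite (perm_mem (pairs_perm hv)) mem_iota sz.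
have [|t et] := @lift_pairs n.*2 (pairs [::] e).
  by move=> q /hlt[h1 h2]; split => //; apply: ltn_trans h1 h2.
pose M := [set p in t].
have e1 : unzip1 (pairs [::] e) = [seq val p.1 | p <- t] by rewrite et /unzip1 -map_comp.
have e2 : unzip2 (pairs [::] e) = [seq val p.2 | p <- t] by rewrite et /unzip2 -map_comp.
have hperm := pairs_perm hv; rewrite e1 e2 sz /= in hperm.
have hmem p : p \in M -> (val p.1, val p.2) \in pairs [::] e.
  by rewrite inE et => hp; apply/mapP; exists p.
have huniq : uniq ([seq val p.1 | p <- t] ++ [seq val p.2 | p <- t]).
  by rewrite (perm_uniq hperm) iota_uniq.
have hM : is_matching M.
  apply/is_matchingP; split.
  - by move=> p /hmem/hlt[].
  - move=> v; have : val v \in [seq val p.1 | p <- t] ++ [seq val p.2 | p <- t].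
      by rewrite (perm_mem hperm) mem_iota /= add0n ltn_ord.
    rewrite mem_cat => /orP[] /mapP[p hp /val_inj ev]; exists p; rewrite ?inE ?ev ?eqxx ?orbT //.
  - move: huniq; rewrite cat_uniq => /and3P[u1 /hasPn u12 u2] p q v; rewrite !inE.
    move=> hp hq /orP[]/eqP-> /orP[]/eqP e0.
    + by apply: (map_uniq_inj u1) => //; rewrite /= e0.
    + by case/negP: (u12 (val q.2) (map_f _ hq)); rewrite -e0; apply: map_f.
    + by case/negP: (u12 (val p.2) (map_f _ hp)); rewrite e0; apply: map_f.
    + by apply: (map_uniq_inj u2) => //; rewrite /= e0.
exists M => //.
have [] := @code_pairs n.*2 (partner M) [::] e (partner_inv hM) _ hv isT _.
- by rewrite sz.
- move=> q; rewrite et => /mapP[p hp ->] /=; apply: partner_mem => //.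
  by rewrite inE.
by rewrite sz.
Qed.

(** * Counting by shapes *)

Lemma card_matching_codes (n : nat) (p : pred (seq (option nat))) :
  #|[set M : matching n | p (code (partner (val M)) n.*2)]| =
  count p (codes n.*2 0).
Proof.
pose T : finType := matching n; pose f (M : T) := code (partner (val M)) n.*2.
have finj : injective f.
  by move=> M M' /(partner_code_inj (valP M) (valP M'))/val_inj.
have hperm : perm_eq [seq f M | M <- enum T] (codes n.*2 0).
  apply: uniq_perm; first by rewrite (map_inj_uniq finj); apply: enum_uniq.
    exact: codes_uniq.
  move=> e; apply/mapP/idP => [[M _ ->]|he].
    rewrite mem_codes size_code eqxx /=.
    have hs := partner_inv (valP M).
    by have := code_valid hs (leqnn _); rewrite (opensN hs).
  have [M hM <-] := partner_code_surj he.
  by exists (Sub M hM : T); rewrite ?mem_enum // /f SubK.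
rewrite -(seq.permP hperm) count_map -sum1_card -sum1_count big_enum_cond /=.
by apply: eq_bigl => M; rewrite !inE.
Qed.

Section lattice_word_counting.
Variables (k j : nat).

Definition good_count (n : nat) (Y : seq nat) : nat :=
  count (good k j Y) (codes n (size Y)).

Lemma goodE (Y : seq nat) e : good k j Y e = inbox k j Y &&
  match e with
  | [::] => true
  | None :: e' => good k j (behead Y) e'
  | Some r :: e' => good k j (ins r Y).1 e'
  end.
Proof. by case: e. Qed.

Lemma good_count_out (n : nat) (Y : seq nat) : ~~ inbox k j Y -> good_count n Y = 0.
Proof.
move=> h; rewrite /good_count (eq_count (a2 := pred0)) ?count_pred0 // => e.
by rewrite goodE (negbTE h).
Qed.

Lemma good_count0 (Y : seq nat) : good_count 0 Y = (Y == [::]).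
Proof. by case: Y. Qed.

Lemma good_countS (n : nat) (Y : seq nat) : inbox k j Y ->
  good_count n.+1 Y = (if Y is _ :: Y' then good_count n Y' else 0) +
                \sum_(0 <= r < (size Y).+1) good_count n (ins r Y).1.
Proof.
move=> hY; rewrite /good_count codesS count_cat; congr (_ + _).
  case: Y hY => //= x Y hY; rewrite count_map; apply: eq_count => e /=.
  by rewrite hY.
rewrite count_flatten sumnE big_map big_map /index_iota subn0.
apply: eq_bigr => r _; rewrite count_map size_ins; apply: eq_count => e /=.
by rewrite hY.
Qed.

(** The length of column [i] of the diagram whose row [c] has [count_mem c Y] cells; [lt_cols] is
    the conjugation of partitions. *)
Definition cols (Y : seq nat) (i : nat) : nat :=
  count (fun c => i < count_mem c Y) (iota 0 k).

Lemma count_iota_anti (p : pred nat) (m c : nat) :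
  (forall c, p c.+1 -> p c) -> (c < count p (iota 0 m)) = (c < m) && p c.
Proof.
move=> hp; have hp' d e : p (d + e) -> p d.
  by elim: e => [|e IH]; rewrite ?addn0 // addnS => /hp.
elim: m => // m IH; rewrite count_iotaS; case: (boolP (p m)) => pm.
  suff -> : count p (iota 0 m) = m.
    rewrite addn1 ltnS; case: leqP => //= h; apply/esym.
    by apply: (hp' c (m - c)); rewrite subnKC.
  rewrite -[RHS](size_iota 0 m) -[RHS]count_predT; apply: eq_in_count => d.
  rewrite mem_iota /= add0n => h.
  by apply: (hp' d (m - d)); rewrite subnKC // ltnW.
rewrite addn0 IH ltnS (leq_eqVlt c) andb_orl; case: eqP => [e|_] //.
by rewrite e (negbTE pm) andbF.
Qed.

Lemma lt_cols (Y : seq nat) (i c : nat) : latt Y ->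
  (c < cols Y i) = (c < k) && (i < count_mem c Y).
Proof.
move=> lY; apply: count_iota_anti => d h.
exact: leq_trans h (latt_count _ lY).
Qed.

Lemma cols_le (Y : seq nat) (i : nat) : cols Y i <= k.
Proof. by rewrite -[X in _ <= X](size_iota 0 k) count_size. Qed.

Lemma eq_lt (a b : nat) : (forall c, (c < a) = (c < b)) -> a = b.
Proof.
move=> h; apply/eqP; rewrite eqn_leq; apply/andP; split; rewrite leqNgt.
  by rewrite h ltnn.
by rewrite -h ltnn.
Qed.

Notation shape := {ffun 'I_j -> 'I_k.+1}.

(* Shapes are given by their column lengths. *)
Definition shape_of (Y : seq nat) : shape := [ffun i : 'I_j => inord (cols Y i)].

Lemma shape_ofE (Y : seq nat) (i : 'I_j) : shape_of Y i = cols Y i :> nat.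
Proof. by rewrite ffunE inordK // ltnS cols_le. Qed.

Definition decr (a : shape) : bool :=
  [forall i : 'I_j, forall i' : 'I_j, (i <= i') ==> (a i' <= a i)].

Definition addable (a : shape) (i : 'I_j) : bool :=
  (a i < k) && [forall i' : 'I_j, (i'.+1 == i) ==> (a i < a i')].

Definition removable (a : shape) (i : 'I_j) : bool :=
  (0 < a i) && [forall i' : 'I_j, (i' == i.+1 :> nat) ==> (a i' < a i)].

Definition up (a : shape) (i : 'I_j) : shape :=
  [ffun i' => if i' == i then inord (a i).+1 else a i'].

Definition down (a : shape) (i : 'I_j) : shape :=
  [ffun i' => if i' == i then inord (a i).-1 else a i'].

Lemma decrP (a : shape) :
  reflect (forall i i' : 'I_j, i <= i' -> a i' <= a i) (decr a).
Proof.
by apply: (iffP 'forall_forallP) => h i i'; [apply/implyP|apply/implyP; apply: h].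
Qed.

Lemma upE (a : shape) (i i' : 'I_j) : addable a i ->
  up a i i' = (a i' + (i' == i)) :> nat.
Proof.
case/andP=> h _; rewrite ffunE; case: eqP => [->|_]; last by rewrite addn0.
by rewrite inordK ?addn1.
Qed.

Lemma downE (a : shape) (i i' : 'I_j) : down a i i' = (a i' - (i' == i)) :> nat.
Proof.
rewrite ffunE; case: eqP => [->|_]; last by rewrite subn0.
by rewrite inordK ?subn1 // (leq_ltn_trans (leq_pred _)).
Qed.

Lemma inbox_perm (Y Z : seq nat) : perm_eq Y Z -> inbox k j Y = inbox k j Z.
Proof. by move=> h; rewrite /inbox (perm_all _ h) (seq.permP h). Qed.

Lemma shape_perm (Y Z : seq nat) : perm_eq Y Z -> shape_of Y = shape_of Z.
Proof.
move=> h; apply/ffunP => i; rewrite !ffunE; congr inord.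
by apply: eq_count => c; rewrite (seq.permP h).
Qed.

Lemma perm_ins (r : nat) (Y : seq nat) :
  perm_eq (ins r Y).1 ((ins r Y).2 :: Y).
Proof.
apply/allP => x _ /=.
by rewrite count_ins addnC.
Qed.

(** The new cell ends row [c], hence lies in column [count_mem c Y], whose length was [c]. *)
Lemma shape_cons (c : nat) (Y : seq nat) : latt Y -> inbox k j Y ->
  latt (c :: Y) -> inbox k j (c :: Y) ->
  exists i : 'I_j, [/\ i = count_mem c Y :> nat, addable (shape_of Y) i,
     shape_of Y i = c :> nat & shape_of (c :: Y) = up (shape_of Y) i].
Proof.
move=> lY bY lcY /andP[/= /andP[ck _] bcY].
have hc0 : count_mem c Y <= count_mem 0 Y.
  elim: (c) => // d IH; exact: leq_trans (latt_count d lY) IH.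
have hj : count_mem c Y < j.
  case/andP: bY => _ b0.
  case: (c) hc0 bcY lcY => [|c'] hc0 /= bcY; first by move=> _; lia.
  move=> /andP[_]; have : count_mem c' Y <= count_mem 0 Y.
    elim: (c') => // d IH; exact: leq_trans (latt_count d lY) IH.
  by move: b0 => /= ; lia.
exists (Ordinal hj); set i := Ordinal hj.
have ec : cols Y i = c.
  apply: eq_lt => d; rewrite lt_cols //=.
  case: (ltngtP d c) => [dc|cd|->]; last by rewrite ltnn andbF.
    rewrite (ltn_trans dc ck) /=; move: lcY => /= /andP[_ /orP[/eqP e|]].
      by rewrite e in dc.
    move=> h; apply: leq_trans h _.
    have -> : c.-1 = d + (c.-1 - d) by lia.
    elim: (c.-1 - d) => [|e IH]; rewrite ?addn0 // addnS.
    exact: leq_trans (latt_count _ lY) IH.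
  apply/negbTE; rewrite negb_and; apply/orP; right; rewrite -leqNgt.
  have -> : d = c + (d - c) by lia.
  elim: (d - c) => [|e IH]; rewrite ?addn0 // addnS.
  exact: leq_trans (latt_count _ lY) IH.
have eup (i' : 'I_j) : cols (c :: Y) i' = cols Y i' + (i' == i).
  apply: eq_lt => d; rewrite lt_cols //=.
  case: (i' =P i) => [->|ni].
    rewrite ec /= addn1 ltnS; case: (ltngtP d c) => [dc|cd|->].
    - have := lt_cols i d lY; rewrite ec dc => /esym/andP[-> h].
      exact: h.
    - by have := lt_cols i d lY; rewrite ec [d < c]ltnNge (ltnW cd) => /esym.
    - by rewrite ck add1n ltnSn.
  rewrite addn0 lt_cols //; case: (altP (c =P d)) => [<-|_]; last by rewrite add0n.
  rewrite add1n ck /= ltnS leq_eqVlt; case: eqP => //= e.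
  by case: ni; apply: val_inj.
have hadd : addable (shape_of Y) i.
  rewrite /addable shape_ofE ec ck /=; apply/forallP => i'; apply/implyP => /eqP hi'.
  by rewrite shape_ofE lt_cols // ck /= hi'.
split => //; first by rewrite shape_ofE.
by apply/ffunP => i'; apply: val_inj; rewrite [LHS]/= [RHS]/= upE // !shape_ofE eup.
Qed.

Lemma latt_cons_addable (Y : seq nat) (i : 'I_j) (c : nat) :
  latt Y -> inbox k j Y -> addable (shape_of Y) i -> shape_of Y i = c :> nat ->
  [/\ count_mem c Y = i, latt (c :: Y) & inbox k j (c :: Y)].
Proof.
move=> lY bY /andP[hk /forallP hi] cE; rewrite cE in hk hi.
have ec : cols Y i = c by rewrite -shape_ofE.
have ck : c < k by [].
have h1 : count_mem c Y <= i.
  have := lt_cols i c lY; rewrite ec ltnn ck /= => /esym/negbT.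
  by rewrite -leqNgt.
have h2 : i <= count_mem c Y.
  case: (posnP i) => [->//|i0].
  have hi' : i.-1 < j by have := ltn_ord i; lia.
  have /implyP := hi (Ordinal hi'); rewrite /= prednK // eqxx => /(_ isT).
  by rewrite (shape_ofE Y (Ordinal hi')) lt_cols //= => /andP[_]; rewrite prednK.
have e : count_mem c Y = i by apply/eqP; rewrite eqn_leq h1.
split=> //.
  rewrite /= lY /=; case: (posnP c) => [->//|c0].
  have : c.-1 < cols Y i by rewrite ec; lia.
  by rewrite lt_cols // => /andP[_]; rewrite e.
case/andP: bY => b1 b2; rewrite /inbox /= ck b1 /=.
case: eqP => [c0|_] //; rewrite c0 in e; rewrite e add1n; exact: ltn_ord.
Qed.

Lemma shape_decr (Y : seq nat) : decr (shape_of Y).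
Proof.
apply/decrP => i i' h; rewrite !shape_ofE; apply: sub_count => c.
exact: leq_ltn_trans.
Qed.

Lemma shape_counts (Y Z : seq nat) (c : nat) : latt Y -> latt Z ->
  inbox k j Y -> inbox k j Z -> shape_of Y = shape_of Z ->
  count_mem c Y = count_mem c Z.
Proof.
move=> lY lZ bY bZ E; apply: eq_lt => i.
have out W : inbox k j W -> k <= c -> count_mem c W = 0.
  move=> /andP[/allP h _] kc; apply/count_memPn; apply/negP => /h /=; lia.
case: (ltnP c k) => ck; last by rewrite !out.
have lej W : latt W -> inbox k j W -> count_mem c W <= j.
  move=> lW /andP[_]; apply: leq_trans.
  elim: (c) => // d IH; exact: leq_trans (latt_count d lW) IH.
case: (ltnP i j) => ij; last first.
  by rewrite !ltnNge !(leq_trans _ ij) ?lej.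
have := lt_cols i c lY; have := lt_cols i c lZ; rewrite ck /= => <- <-.
by rewrite -!(shape_ofE _ (Ordinal ij)) E.
Qed.

Fixpoint words (s : nat) : seq (seq nat) :=
  if s is s'.+1 then [::] :: [seq c :: Y | c <- iota 0 k, Y <- words s']
  else [:: [::]].

Lemma mem_words (s : nat) (Y : seq nat) :
  (Y \in words s) = (size Y <= s) && all (ltn^~ k) Y.
Proof.
elim: s Y => [|s IH] [|c Y] //=; rewrite inE /=.
apply/allpairsP/idP.
  case=> -[c' Y'] [/=]; rewrite mem_iota add0n IH => h1 h2 [-> ->].
  by move: h2 => /andP[h2 h3]; rewrite ltnS h2 h3 andbT.
rewrite ltnS => /and3P[h1 h2 h3]; exists (c, Y).
by rewrite mem_iota IH h1 h3.
Qed.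

Lemma words_uniq (s : nat) : uniq (words s).
Proof.
elim: s => //= s IH; apply/andP; split.
  by apply/allpairsP => -[[c Y] [_ _]].
apply: allpairs_uniq; rewrite ?iota_uniq //.
by move=> [c Y] [c' Y'] _ _ /= [-> ->].
Qed.

Definition lwords : seq (seq nat) :=
  [seq Y <- words (k * j) | latt Y && inbox k j Y].

Lemma mem_lwords (Y : seq nat) : (Y \in lwords) = latt Y && inbox k j Y.
Proof.
rewrite mem_filter mem_words; case: (boolP (latt Y)) => //= lY.
case: (boolP (inbox k j Y)) => //= /andP[hk h0]; rewrite hk andbT.
have -> : size Y = \sum_(c < k) count_mem (val c) Y.
  elim: Y hk {lY h0} => [|x Y IH] /=; first by rewrite big1.
  move=> /andP[hx /IH->]; rewrite big_split /= [X in _ = X + _](bigD1 (Ordinal hx)) //= eqxx.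
  rewrite [X in _ = _ + X + _]big1 // => i /eqP hi.
  by case: eqP => // e; case: hi; apply: val_inj.
apply: (@leq_trans (\sum_(c < k) j)); last by rewrite sum_nat_const card_ord.
apply: leq_sum => c _; apply: leq_trans h0.
elim: (val c) => // d IH; exact: leq_trans (latt_count d lY) IH.
Qed.

Lemma mem_filter_lwords (p : pred (seq nat)) (Y : seq nat) :
  (Y \in [seq Y <- lwords | p Y]) = p Y && (latt Y && inbox k j Y).
Proof. by rewrite mem_filter mem_lwords. Qed.

Lemma lwords_uniq : uniq lwords.
Proof. exact: filter_uniq (words_uniq _). Qed.

(** The sum runs over all tableaux of the shape because the insertions into a single tableau do not
    exhaust the tableaux of the larger shapes. *)
Definition shape_cnt (n : nat) (a : shape) : nat :=
  \sum_(Y <- lwords | shape_of Y == a) good_count n Y.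

Lemma sum_exists_unique (T : Type) (J : finType) (s : seq T) (P : J -> pred T)
    (f : T -> nat) :
  (forall i i' x, P i x -> P i' x -> i = i') ->
  \sum_(x <- s | [exists i, P i x]) f x = \sum_i \sum_(x <- s | P i x) f x.
Proof.
move=> uP.
rewrite [RHS](eq_bigr (fun i => \sum_(x <- s) if P i x then f x else 0)); last first.
  by move=> i _; rewrite big_mkcond.
rewrite [RHS]exchange_big [LHS]big_mkcond; apply: eq_bigr => x _ /=.
case: existsP => [[i hi]|h].
  rewrite (bigD1 i) //= hi big1 ?addn0 // => i' /eqP ni.
  by case: ifP => // h; case: ni; apply: uP h hi.
rewrite big1 // => i _; case: ifP => // hi; case: h; by exists i.
Qed.

Lemma up_inj (a : shape) (i i' : 'I_j) :
  addable a i -> addable a i' -> up a i = up a i' -> i = i'.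
Proof.
move=> h h' /ffunP/(_ i)/(congr1 val) /=; rewrite !upE // eqxx.
by case: eqP => // _ /eqP; rewrite eqn_add2l.
Qed.

Lemma down_inj (a : shape) (i i' : 'I_j) :
  removable a i -> removable a i' -> down a i = down a i' -> i = i'.
Proof.
move=> /andP[h _] _ /ffunP/(_ i)/(congr1 val) /=; rewrite !downE // eqxx.
by case: eqP => // _ /eqP; rewrite subn0; lia.
Qed.

(** Insertion maps the pairs [(Y, r)], with [Y] of shape [a], bijectively onto the tableaux with one
    more cell than [a]; those that leave the box contribute 0. *)
Lemma sum_ins (n : nat) (a : shape) : decr a ->
  \sum_(Y <- lwords | shape_of Y == a)
     \sum_(0 <= r < (size Y).+1) good_count n (ins r Y).1 =
  \sum_(i | addable a i) shape_cnt n (up a i).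
Proof.
move=> da.
pose L := [seq (ins r Y).1 | Y <- [seq Y <- lwords | shape_of Y == a],
                             r <- iota 0 (size Y).+1].
pose P i Z := addable a i && (shape_of Z == up a i).
have -> : \sum_(i | addable a i) shape_cnt n (up a i) =
    \sum_i \sum_(Z <- lwords | P i Z) good_count n Z.
  rewrite big_mkcond; apply: eq_bigr => i _; rewrite /P.
  by case: ifP => hi //=; rewrite big_pred0.
rewrite -sum_exists_unique //; last first.
  by move=> i i' Z /andP[hi /eqP e] /andP[hi' /eqP e']; apply: (up_inj hi hi'); rewrite -e.
transitivity (\sum_(Z <- L) good_count n Z).
  rewrite /L big_allpairs_dep big_filter; apply: eq_bigr => Y _.
  by rewrite /index_iota subn0.
transitivity (\sum_(Z <- [seq Z <- L | inbox k j Z]) good_count n Z).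
  rewrite big_filter [RHS]big_mkcond; apply: eq_bigr => Z _.
  by case: ifPn => // /good_count_out.
rewrite -[RHS]big_filter; apply: perm_big; apply: uniq_perm.
- apply: filter_uniq; apply: allpairs_uniq_dep.
  + exact: filter_uniq lwords_uniq.
  + by move=> Y _; apply: iota_uniq.
  move=> [Y r] [Y' r'] /allpairsPdep[Y1 [r1 [h1 h2 [eY er]]]].
  move=> /allpairsPdep[Y2 [r2 [h3 h4 [eY' er']]]] /= E; subst.
  move: h1 h3; rewrite !mem_filter_lwords.
  move=> /andP[/eqP s1 /andP[l1 b1]] /andP[/eqP s2 /andP[l2 b2]].
  (* Equal shapes have equal row lengths, so [E] forces the new cells into the same row, as
     [ins_inj] requires. *)
  have hc d : count_mem d Y1 = count_mem d Y2.
    by apply: shape_counts => //; rewrite s1 s2.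
  have ec : (ins r1 Y1).2 = (ins r2 Y2).2.
    have := count_ins r1 (ins r1 Y1).2 Y1; rewrite E count_ins hc eqxx => /addnI.
    by case: (altP (_ =P _)) => [->|].
  have [] := @ins_inj r1 r2 Y1 Y2.
  + by move: h2; rewrite mem_iota /= add0n ltnS.
  + by move: h4; rewrite mem_iota /= add0n ltnS.
  + by rewrite [LHS]surjective_pairing [RHS]surjective_pairing E ec.
  by move=> -> ->.
- exact: filter_uniq lwords_uniq.
move=> Z; rewrite mem_filter_lwords mem_filter.
apply/andP/andP.
  case=> bZ /allpairsPdep[Y [r [h1 h2 eZ]]].
  move: h1; rewrite mem_filter_lwords => /andP[/eqP sY /andP[lY bY]].
  have lZ : latt Z by rewrite eZ latt_ins.
  rewrite lZ bZ; split => //.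
  have pZ : perm_eq Z ((ins r Y).2 :: Y) by rewrite eZ perm_ins.
  set c := (ins r Y).2 in pZ.
  have bcY : inbox k j (c :: Y) by rewrite -(inbox_perm pZ).
  have lcY : latt (c :: Y).
    rewrite /= lY /=; case: (c) pZ => //= c' pZ.
    have := latt_count c' lZ; rewrite !(seq.permP pZ) /= eqxx.
    by have -> : (c'.+1 == c') = false by lia.
  have [i [_ hi _ e]] := shape_cons lY bY lcY bcY.
  by apply/existsP; exists i; rewrite /P -sY hi (shape_perm pZ) e eqxx.
case=> /existsP[i /andP[hi /eqP sZ]] /andP[lZ bZ]; split => //.
have aE (i' : 'I_j) : cols Z i' = a i' + (i' == i) :> nat by rewrite -shape_ofE sZ upE.
(* The cell added to column [i] lies in row [c]; [c1] and [c2] show that it is a corner of [Z], from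
   which [ins_surj] extracts [Y] and [r]. *)
set c := nat_of_ord (a i).
have ck : c < k by case/andP: hi.
have c1 : count_mem c Z = i.+1.
  have h1 : i < count_mem c Z.
    have := lt_cols i c lZ; rewrite aE eqxx addn1 ltnSn => /esym/andP[]//.
  apply/eqP; rewrite eqn_leq h1 andbT.
  case: (ltnP i.+1 j) => hj; last first.
    apply: leq_trans hj; case/andP: bZ => _; apply: leq_trans.
    elim: (c) => // d IH; exact: leq_trans (latt_count d lZ) IH.
  have := lt_cols i.+1 c lZ; rewrite (aE (Ordinal hj)) ck /=.
  have -> : (Ordinal hj == i) = false by apply/eqP => /(congr1 val) /=; lia.
  have := decrP _ da i (Ordinal hj) (leqnSn _).
  by rewrite addn0 -/c => h /esym; case: ltnP => // _; lia.
have c2 : count_mem c.+1 Z <= i.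
  have := lt_cols i c.+1 lZ; rewrite aE eqxx addn1 ltnn => /esym/negbT.
  rewrite negb_and -!leqNgt => /orP[kc|//].
  suff -> : count_mem c.+1 Z = 0 by [].
  case/andP: bZ => /allP hZ _; apply/count_memPn; apply/negP => /hZ /=; lia.
have [|Y [r [lY hr E]]] := @ins_surj c Z lZ; first by rewrite c1.
have pZ : perm_eq Z (c :: Y).
  by have := perm_ins r Y; rewrite E.
have bY : inbox k j Y.
  move: bZ; rewrite (inbox_perm pZ) /inbox /= => /andP[/andP[_ ->] h].
  by apply: leq_trans h; apply: leq_addl.
have lcY : latt (c :: Y).
  rewrite /= lY /=; case: (c) pZ => //= c' pZ.
  have := latt_count c' lZ; rewrite !(seq.permP pZ) /= eqxx.
  by have -> : (c'.+1 == c') = false by lia.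
have bcY : inbox k j (c :: Y) by rewrite -(inbox_perm pZ).
have [i0 [e0 hi0 e1 e2]] := shape_cons lY bY lcY bcY.
have ei : i0 = i.
  by apply: val_inj => /=; rewrite e0; move: c1; rewrite (seq.permP pZ) /= eqxx => -[].
have sY : shape_of Y = a.
  apply/ffunP => i'; apply: val_inj => /=.
  have := aE i'; rewrite -shape_ofE (shape_perm pZ) e2 ei upE -?ei //.
  by move/eqP; rewrite eqn_add2r => /eqP.
apply/allpairsPdep; exists Y, r; split; last by rewrite E.
- by rewrite mem_filter_lwords sY eqxx lY.
- by rewrite mem_iota /= add0n ltnS.
Qed.

(** Deleting the largest entry maps the non-empty tableaux of shape [a] bijectively onto the
    tableaux of the shapes with one cell less. *)
Lemma sum_behead (n : nat) (a : shape) : decr a ->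
  \sum_(Y <- lwords | shape_of Y == a) (if Y is _ :: Y' then good_count n Y' else 0) =
  \sum_(i | removable a i) shape_cnt n (down a i).
Proof.
move=> da.
pose L := [seq behead Y | Y <- [seq Y <- lwords | (shape_of Y == a) && (Y != [::])]].
pose P i Z := removable a i && (shape_of Z == down a i).
have -> : \sum_(i | removable a i) shape_cnt n (down a i) =
    \sum_i \sum_(Z <- lwords | P i Z) good_count n Z.
  rewrite big_mkcond; apply: eq_bigr => i _; rewrite /P.
  by case: ifP => hi //=; rewrite big_pred0.
rewrite -sum_exists_unique //; last first.
  by move=> i i' Z /andP[hi /eqP e] /andP[hi' /eqP e']; apply: (down_inj hi hi'); rewrite -e.
transitivity (\sum_(Z <- L) good_count n Z).
  rewrite /L big_map big_filter [LHS]big_mkcond [RHS]big_mkcond; apply: eq_bigr => Y _.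
  by case: (shape_of Y == a); case: Y.
rewrite -[RHS]big_filter; apply: perm_big; apply: uniq_perm.
- rewrite map_inj_in_uniq; first exact: filter_uniq lwords_uniq.
  move=> [|x Y] [|x' Y']; rewrite !mem_filter_lwords ?andbF //.
  move=> /andP[/andP[/eqP s1 _] /andP[l1 b1]] /andP[/andP[/eqP s2 _] /andP[l2 b2]] /= e.
  have := @shape_counts (x :: Y) (x' :: Y') x l1 l2 b1 b2 (etrans s1 (esym s2)).
  by rewrite /= e eqxx => /addIn; case: (altP (_ =P _)) => [->|].
- exact: filter_uniq lwords_uniq.
have bcons x Y : inbox k j (x :: Y) -> inbox k j Y.
  rewrite /inbox /= => /andP[/andP[_ ->] h].
  by apply: leq_trans h; apply: leq_addl.
move=> Z; apply/mapP/idP => [[[|x Y]]|].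
- by rewrite mem_filter_lwords andbF.
- rewrite !mem_filter_lwords /= => /andP[/andP[/eqP sY _] /andP[lxY bY]] ->.
  have lY : latt Y by case/andP: lxY.
  have bY' := bcons _ _ bY.
  have [i [_ hi e1 e2]] := shape_cons lY bY' lxY bY.
  rewrite lY bY' !andbT; apply/existsP; exists i.
  have aE (i' : 'I_j) : a i' = (shape_of Y i' + (i' == i)) :> nat by rewrite -sY e2 upE.
  apply/andP; split.
    rewrite /removable aE eqxx addn1 /=; apply/forallP => i'; apply/implyP => /eqP hi'.
    rewrite aE; have -> : (i' == i) = false by apply/eqP => e; move: hi'; rewrite e; lia.
    by rewrite addn0 ltnS; apply: (decrP _ (shape_decr Y)); rewrite hi'.
  by apply/eqP/ffunP => i'; apply: val_inj => /=; rewrite downE aE addnK.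
rewrite mem_filter_lwords => /andP[/existsP[i /andP[/andP[h0 /forallP hi] /eqP sZ]] /andP[lZ bZ]].
have zE (i' : 'I_j) : shape_of Z i' = (a i' - (i' == i)) :> nat by rewrite sZ downE.
have hadd : addable (shape_of Z) i.
  rewrite /addable zE eqxx subn1; apply/andP; split.
    by rewrite prednK // -ltnS ltn_ord.
  apply/forallP => i'; apply/implyP => /eqP hi'; rewrite zE.
  have -> : (i' == i) = false by apply/eqP => e; move: hi'; rewrite e; lia.
  rewrite subn0 prednK //; apply: (decrP _ da); by rewrite -hi'.
have [e1 e2 e3] := latt_cons_addable lZ bZ hadd erefl.
exists (nat_of_ord (shape_of Z i) :: Z) => //.
rewrite mem_filter_lwords e2 e3 !andbT /=.
have [i0 [h1 h2 h3 ->]] := shape_cons lZ bZ e2 e3.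
have ei : i0 = i by apply: val_inj => /=; rewrite h1 e1.
apply/eqP/ffunP => i'; apply: val_inj => /=; rewrite ei upE // zE.
by case: eqP => [->|_]; rewrite ?subn0 ?addn0 // subnK.
Qed.

Lemma shape_cntS (n : nat) (a : shape) : decr a ->
  shape_cnt n.+1 a = \sum_(i | addable a i) shape_cnt n (up a i) +
                     \sum_(i | removable a i) shape_cnt n (down a i).
Proof.
move=> da; rewrite -sum_ins // -sum_behead // /shape_cnt.
rewrite addnC -big_split /= [LHS]big_seq_cond [RHS]big_seq_cond.
apply: eq_bigr => Y; rewrite mem_lwords => /andP[/andP[_ bY] _].
by rewrite good_countS.
Qed.

Lemma shape_cnt_nil (n : nat) : shape_cnt n (shape_of [::]) = good_count n [::].
Proof.
rewrite /shape_cnt big_mkcond (bigD1_seq [::]) ?lwords_uniq ?mem_lwords //= eqxx.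
rewrite big_seq_cond big1 ?addn0 // => -[|x Y] /andP[]; rewrite mem_lwords // => /andP[lY bY] _.
case: eqP => // e; have := @shape_counts (x :: Y) [::] x lY isT bY isT e.
by rewrite /= eqxx.
Qed.

Lemma shape_cnt0 (a : shape) : shape_cnt 0 a = (a == shape_of [::]).
Proof.
rewrite /shape_cnt big_mkcond (bigD1_seq [::]) ?lwords_uniq ?mem_lwords //=.
rewrite big1 => [|Y /negbTE hY]; last by rewrite good_count0 hY; case: ifP.
by rewrite eq_sym addn0; case: eqP.
Qed.

End lattice_word_counting.

Lemma card_good_matchings (n k j : nat) :
  #|[set M : matching n | (cr M <= k) && (ne M <= j)]| =
  shape_cnt n.*2 (shape_of k j [::]).
Proof.
rewrite shape_cnt_nil /good_count -(card_matching_codes n (good k j [::])).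
by apply: eq_card => M; rewrite !inE cr_ne_code.
Qed.

Lemma card_matching (n : nat) : #|{: matching n}| * (2 ^ n * n`!) = (n.*2)`!.
Proof.
rewrite -dfact_fact -cardsT; congr (_ * _).
have := card_matching_codes n predT; rewrite count_predT size_codes bin0 mul1n subn0 => <-.
by apply: eq_card => M; rewrite !inE.
Qed.

Lemma shape_cnt_odd (n k j : nat) : shape_cnt n.*2.+1 (shape_of k j [::]) = 0.
Proof.
rewrite shape_cnt_nil /good_count.
suff : size (codes n.*2.+1 (@size nat [::])) = 0 by move/size0nil->.
rewrite size_codes bin0 subn0 mul1n.
by elim: n => //= n ->; rewrite muln0.
Qed.

Import Order.TTheory GRing.Theory Num.Theory.
Import numFieldNormedType.Exports.
Local Open Scope classical_set_scope.
Local Open Scope ring_scope.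
Local Open Scope complex_scope.

(** * Calculus *)

Section derivative_rules.
Variable R : realType.
Implicit Types (f g : R -> R) (x a b : R).

Lemma is_derive_cstf x (c : R) : is_derive x 1 (fun=> c) 0.
Proof. exact: is_derive_cst. Qed.

Lemma is_derive_addf f g x a b : is_derive x 1 f a -> is_derive x 1 g b ->
  is_derive x 1 (fun s => f s + g s) (a + b).
Proof. by move=> ? ?; apply: is_deriveD. Qed.

Lemma is_derive_oppf f x a : is_derive x 1 f a -> is_derive x 1 (fun s => - f s) (- a).
Proof. by move=> ?; apply: is_deriveN. Qed.

Lemma is_derive_subf f g x a b : is_derive x 1 f a -> is_derive x 1 g b ->
  is_derive x 1 (fun s => f s - g s) (a - b).
Proof. by move=> ? ?; apply: is_deriveB. Qed.

Lemma is_derive_mulf f g x a b : is_derive x 1 f a -> is_derive x 1 g b ->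
  is_derive x 1 (fun s => f s * g s) (a * g x + f x * b).
Proof.
move=> hf hg; have H : is_derive x 1 (f * g) (a * g x + f x * b).
  by apply: is_derive_eq; rewrite /GRing.scale /=; ring.
exact: H.
Qed.

Lemma is_derive_invf f x a : f x != 0 -> is_derive x 1 f a ->
  is_derive x 1 (fun s => (f s)^-1) (- a / f x ^+ 2).
Proof.
move=> fx [df <-]; apply: DeriveDef; first exact: derivableV.
by rewrite deriveV // /GRing.scale /=; field.
Qed.

Lemma is_derive_compf f g x a b : is_derive (g x) 1 f a -> is_derive x 1 g b ->
  is_derive x 1 (fun s => f (g s)) (a * b).
Proof. by move=> hf hg; have H := is_derive1_comp hf hg; exact: H. Qed.

Lemma is_derive_sumf (I : Type) (r : seq I) (P : pred I) (F : I -> R -> R) (dF : I -> R) x :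
  (forall i, P i -> is_derive x 1 (F i) (dF i)) ->
  is_derive x 1 (fun s => \sum_(i <- r | P i) F i s) (\sum_(i <- r | P i) dF i).
Proof.
move=> h; elim: r => [|i r IH].
  rewrite big_nil (_ : (fun s => _) = (fun=> 0)); first exact: is_derive_cstf.
  by apply/funext => s; rewrite big_nil.
rewrite big_cons (_ : (fun s => _) = (fun s => if P i then F i s + \sum_(j <- r | P j) F j s
   else \sum_(j <- r | P j) F j s)); last first.
  by apply/funext => s; rewrite big_cons.
by case: ifP => // Pi; apply: is_derive_addf => //; apply: h.
Qed.

Lemma is_derive_prodf (n : nat) (F : 'I_n -> R -> R) (dF : 'I_n -> R) x :
  (forall i, is_derive x 1 (F i) (dF i)) ->
  is_derive x 1 (fun s => \prod_i F i s)
    (\sum_i \prod_i' (if i' == i then dF i' else F i' x)).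
Proof.
elim: n F dF => [|n IH] F dF h.
  rewrite big_ord0 (_ : (fun s => _) = (fun=> 1)); first exact: is_derive_cstf.
  by apply/funext => s; rewrite big_ord0.
rewrite (_ : (fun s => _) = (fun s => F ord0 s * \prod_(i < n) F (lift ord0 i) s)); last first.
  by apply/funext => s; rewrite big_ord_recl.
rewrite big_ord_recl big_ord_recl eqxx.
rewrite [X in _ * X + _](eq_bigr (fun i => F (lift ord0 i) x)) //.
rewrite [X in _ + X](_ : _ = F ord0 x *
   \sum_(i < n) \prod_(i' < n) (if i' == i then dF (lift ord0 i') else F (lift ord0 i') x)).
  by apply: is_derive_mulf => //; apply: (IH (fun i => F (lift ord0 i)) (fun i => dF (lift ord0 i))).
rewrite mulr_sumr; apply: eq_bigr => i _; rewrite big_ord_recl /=.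
by congr (_ * _); apply: eq_bigr => i' _; rewrite (inj_eq lift_inj).
Qed.

End derivative_rules.

Section calculus.
Variable R : realType.

Lemma derive_continuous (f df : R -> R) :
  (forall x : R, is_derive x 1 f (df x)) -> continuous f.
Proof.
move=> h x; apply: differentiable_continuous; apply/derivable1_diffP.
by case: (h x).
Qed.

Lemma le_of_derive (f df : R -> R) (s : R) : 0 <= s ->
  (forall x : R, is_derive x 1 f (df x)) ->
  (forall x, 0 <= x <= s -> 0 <= df x) -> f 0 <= f s.
Proof.
move=> s0 hf hdf.
have [|c] := @MVT_segment R f df 0 s s0 (fun x _ => hf x).
  by apply: continuous_subspaceT; apply: derive_continuous hf.
rewrite in_itv /= => /hdf c0 e; rewrite -subr_ge0 e subr0.
exact: mulr_ge0.
Qed.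

Lemma is_derive_divfact (c : R) (n : nat) (x : R) :
  is_derive x 1 (fun s => c * s ^+ n.+1 / (n.+1)`!%:R) (c * x ^+ n / n`!%:R).
Proof.
have H : is_derive x 1 (fun s => s ^+ n.+1) (n.+1%:R * x ^+ n).
  elim: n => [|n IH].
    rewrite (_ : (fun s => _) = id); last by apply/funext => s; rewrite expr1.
    by rewrite mul1r expr0; exact: is_derive_id.
  rewrite (_ : (fun s => _) = (fun s : R => s * s ^+ n.+1)); last first.
    by apply/funext => s; rewrite exprS.
  apply: (is_derive_eq (is_derive_mulf (is_derive_id x 1) IH)).
  by rewrite -[n.+2%:R]natr1 exprS /=; ring.
apply: (is_derive_eq (is_derive_mulf (is_derive_mulf (is_derive_cstf x c) H) (is_derive_cstf x (n.+1)`!%:R^-1))).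
have n0 : n`!%:R != 0 :> R by rewrite pnatr_eq0 -lt0n fact_gt0.
have n1 : n.+1%:R != 0 :> R by rewrite pnatr_eq0.
rewrite factS natrM; move: (n`!%:R) n.+1%:R n0 n1 => a b a0 b0.
by field; apply/andP.
Qed.

Lemma bounded_on_segment (f : R -> R) (T : R) : continuous f -> 0 <= T ->
  exists C, 0 <= C /\ forall s, 0 <= s <= T -> `|f s| <= C.
Proof.
move=> cf T0.
have cn : continuous (fun s => `|f s|).
  by move=> s; apply: (continuous_comp (cf s)); exact: norm_continuous.
have [c _ hc] := @EVT_max R (fun s => `|f s|) 0 T T0 (continuous_subspaceT cn).
exists `|f c|; split; first exact: normr_ge0.
by move=> s hs; apply: hc; rewrite in_itv.
Qed.

End calculus.

(** * Power series solution of a finite linear differential system *)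

Section taylor.
Variables (R : realType) (D E : finType) (P : pred D) (w : E -> pred D)
  (tgt : E -> D -> D) (f : D -> R -> R) (u : nat -> D -> nat).
Hypothesis Ptgt : forall a e, P a -> w e a -> P (tgt e a).
Hypothesis f_derive : forall a (t : R), P a ->
  is_derive t 1 (f a) (\sum_(e | w e a) f (tgt e a) t).
Hypothesis f0 : forall a, P a -> f a 0 = (u 0 a)%:R.
Hypothesis uS : forall n a, P a -> u n.+1 a = (\sum_(e | w e a) u n (tgt e a))%N.

Let part (N : nat) (a : D) (t : R) : R :=
  \sum_(0 <= n < N) (u n a)%:R * t ^+ n / n`!%:R.

Lemma part_derive (N : nat) (a : D) (t : R) : P a ->
  is_derive t 1 (part N.+1 a) (\sum_(e | w e a) part N (tgt e a) t).
Proof.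
move=> Pa; rewrite (_ : part N.+1 a = (fun s => (u 0 a)%:R +
    \sum_(i <- index_iota 0 N) (u i.+1 a)%:R * s ^+ i.+1 / (i.+1)`!%:R)); last first.
  apply/funext => s; rewrite /part big_nat_recl // expr0 mulr1 fact0 divr1.
  by congr (_ + _); apply: eq_bigr.
have H := @is_derive_sumf R nat (index_iota 0 N) xpredT
  (fun i s => (u i.+1 a)%:R * s ^+ i.+1 / (i.+1)`!%:R)
  (fun i => (u i.+1 a)%:R * t ^+ i / i`!%:R) t (fun i _ => is_derive_divfact _ i t).
apply: (is_derive_eq (is_derive_addf (is_derive_cstf t _) H)); rewrite add0r /part exchange_big /=.
apply: eq_bigr => n _; rewrite uS // natr_sum mulr_suml mulr_suml.
by apply: eq_bigr.
Qed.

(* The remainder of order [N.+1] is the integral of a sum of remainders of order [N]. *)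
Lemma taylor_bound (T : R) : 0 <= T -> exists C, 0 <= C /\
  forall N a s, P a -> 0 <= s <= T ->
    `|f a s - part N a s| <= C * (#|E|%:R * s) ^+ N / N`!%:R.
Proof.
move=> T0.
have hb a : exists C, 0 <= C /\ (P a -> forall s, 0 <= s <= T -> `|f a s| <= C).
  case: (boolP (P a)) => Pa; last by exists 0.
  have [C [C0 hC]] := bounded_on_segment (derive_continuous (fun x => f_derive x Pa)) T0.
  by exists C.
pose B a := projT1 (cid (hb a)).
have B0 a : 0 <= B a by rewrite /B; case: cid => C [].
have hB a : P a -> forall s, 0 <= s <= T -> `|f a s| <= B a.
  by rewrite /B; case: cid => C [].
(* One constant serves all states, so that the induction on the order can pass from [a] to
   [tgt e a]. *)
exists (\sum_a B a); set C := \sum_a B a; have C0 : 0 <= C by apply: sumr_ge0.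
split => //; elim=> [|N IH] a s Pa hs.
  rewrite /part big_geq // subr0 expr0 mulr1 fact0 divr1.
  apply: le_trans (hB _ Pa _ hs) _; rewrite /C (bigD1 a) //= lerDl.
  exact: sumr_ge0.
have d (x : R) := is_derive_subf (f_derive x Pa) (part_derive N x Pa).
set K : R := #|E|%:R.
pose g (x : R) := C * K ^+ N.+1 * x ^+ N.+1 / (N.+1)`!%:R.
have dg (x : R) : is_derive x 1 g (C * K ^+ N.+1 * x ^+ N / N`!%:R) by exact: is_derive_divfact.
have g0 : g 0 = 0 by rewrite /g expr0n /= mulr0 mul0r.
have gE : g s = C * (K * s) ^+ N.+1 / (N.+1)`!%:R by rewrite /g exprMn mulrA.
rewrite -gE.
have r0 : f a 0 - part N.+1 a 0 = 0.
  rewrite f0 // /part big_nat_recl // expr0 mulr1 fact0 divr1 big1 ?addr0 ?subrr //.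
  by move=> n _; rewrite expr0n /= mulr0 mul0r.
have bd x : 0 <= x <= s ->
    `|\sum_(e | w e a) f (tgt e a) x - \sum_(e | w e a) part N (tgt e a) x| <=
    C * K ^+ N.+1 * x ^+ N / N`!%:R.
  move=> /andP[x0 xs]; rewrite -sumrB.
  apply: le_trans (ler_norm_sum _ _ _) _.
  have hx : 0 <= x <= T by rewrite x0 (le_trans xs) //; case/andP: hs.
  apply: (@le_trans _ _ (\sum_(e | w e a) C * (K * x) ^+ N / N`!%:R)).
    by apply: ler_sum => e we; apply: IH => //; apply: Ptgt.
  rewrite sumr_const -[X in X <= _]mulr_natl.
  have -> : C * K ^+ N.+1 * x ^+ N / N`!%:R = K * (C * (K * x) ^+ N / N`!%:R).
    by rewrite exprS exprMn; ring.
  apply: ler_wpM2r; last by rewrite ler_nat max_card.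
  by rewrite !mulr_ge0 ?invr_ge0 ?exprn_ge0 ?mulr_ge0 ?ler0n.
have s0 : 0 <= s by case/andP: hs.
(* [g] plus or minus the remainder vanishes at 0 and has a nonnegative derivative on the segment. *)
rewrite ler_norml; apply/andP; split.
  have := le_of_derive s0 (fun x => is_derive_addf (dg x) (d x)) => /=.
  rewrite g0 r0 addr0 => h; rewrite -subr_ge0 opprK addrC; apply: h => x hx.
  by have := bd x hx; rewrite ler_norml => /andP[]; lra.
have := le_of_derive s0 (fun x => is_derive_subf (dg x) (d x)) => /=.
rewrite g0 r0 subr0 => h; rewrite -subr_ge0; apply: h => x hx.
by have := bd x hx; rewrite ler_norml => /andP[]; lra.
Qed.

(** The remainder bound is a multiple of the general term of an exponential series, hence tends to
    0. With [u] a walk count, [f] is thus its exponential generating function. *)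
Lemma taylor_cvg (a : D) (t : R) : P a -> 0 <= t ->
  series (fun n => (u n a)%:R * t ^+ n / n`!%:R) @ \oo --> f a t.
Proof.
move=> Pa t0; have [C [C0 hC]] := taylor_bound t0.
apply/subr_cvg0; apply: (@squeeze_cvgr _ _ _ _ (fun N => - (C * (exp_coeff (#|E|%:R * t) N)))
   (fun N => C * (exp_coeff (#|E|%:R * t) N))).
- apply: nearW => N; rewrite -ler_norml distrC.
  have := hC N a t Pa; rewrite lexx t0 => /(_ isT).
  by rewrite /exp_coeff /= mulrA.
- rewrite -oppr0; apply: cvgN; rewrite -[X in _ --> X](mulr0 C); apply: cvgMr.
  exact: cvg_series_cvg_0 (is_cvg_series_exp_coeff _).
- rewrite -[X in _ --> X](mulr0 C); apply: cvgMr.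
  exact: cvg_series_cvg_0 (is_cvg_series_exp_coeff _).
Qed.

End taylor.

Lemma det_derive (R : realType) (n : nat) (A : 'I_n -> 'I_n -> R -> R)
    (dA : 'I_n -> 'I_n -> R) (t : R) :
  (forall i l, is_derive t 1 (A i l) (dA i l)) ->
  is_derive t 1 (fun s => \det (\matrix_(i, l) A i l s))
    (\sum_i \det (\matrix_(i', l) if i' == i then dA i' l else A i' l t)).
Proof.
move=> h.
rewrite (_ : (fun s => _) = (fun s => \sum_(p : 'S_n) (-1) ^+ p * \prod_i A i (p i) s)); last first.
  apply/funext => s; apply: eq_bigr => p _; congr (_ * _); apply: eq_bigr => i _.
  by rewrite mxE.
have H := @is_derive_sumf R 'S_n (index_enum _) xpredT (fun p s => (-1) ^+ p * \prod_i A i (p i) s)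
  (fun p => (-1) ^+ p * \sum_i \prod_i' (if i' == i then dA i' (p i') else A i' (p i') t)) t.
apply: (is_derive_eq (H _)).
  move=> p _; apply: (is_derive_eq (is_derive_mulf (is_derive_cstf t _) (is_derive_prodf (fun i => h i (p i))))).
  by rewrite mul0r add0r.
under eq_bigr do rewrite mulr_sumr; rewrite exchange_big /=.
apply: eq_bigr => i _; apply: eq_bigr => p _; congr (_ * _); apply: eq_bigr => i' _.
by rewrite mxE.
Qed.

(** * Moments of the discrete measure and the Schur flow *)

Section moments.
Variables (R : realType) (m : nat).
Hypothesis m_gt0 : (0 < m)%N.

Definition theta (r : nat) : R := r%:R * (pi / m%:R).

(** The integral of z^-l in real form; [pairing1] shows that its sine part cancels. *)
Definition moment (t : R) (l : int) : R :=
  (m.*2)%:R^-1 *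
  \sum_(r < m.*2) expR (2 * t * cos (theta r)) * cos (l%:~R * theta r).

Lemma m_neq0 : m%:R != 0 :> R. Proof. by rewrite pnatr_eq0 -lt0n. Qed.

Lemma momentN (t : R) (l : int) : moment t (- l) = moment t l.
Proof.
by rewrite /moment; congr (_ * _); apply: eq_bigr => r _; rewrite mulrNz mulNr cosN.
Qed.

Lemma moment_derive (t : R) (l : int) :
  is_derive t 1 (moment^~ l) (moment t (l + 1) + moment t (l - 1)).
Proof.
rewrite /moment -mulrDr -big_split /=.
apply: is_derive_eq.
  apply: (is_derive_mulf (is_derive_cstf t _)).
  apply: (@is_derive_sumf _ _ _ _ (fun r t => expR (2 * t * cos (theta (nat_of_ord r))) * cos (l%:~R * theta r))
     (fun r => expR (2 * t * cos (theta (nat_of_ord r))) * (2 * cos (theta r)) * cos (l%:~R * theta r))).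
  move=> r _ /=; apply: is_derive_eq.
  by rewrite /GRing.scale /=; ring.
rewrite mul0r add0r; congr (_ * _); apply: eq_bigr => r _.
have -> : (l + 1)%:~R * theta r = l%:~R * theta r + theta r by ring.
have -> : (l - 1)%:~R * theta r = l%:~R * theta r - theta r by ring.
by rewrite cosD cosB; ring.
Qed.

Lemma cos_period (a : R) (n : nat) : cos (a + n%:R * (2 * pi)) = cos a.
Proof.
have -> : n%:R * (2 * pi) = (pi *+ 2) *+ n :> R by rewrite -[RHS]mulr_natl -[pi *+ 2]mulr_natl.
exact: (periodicn (@cosD2pi R)).
Qed.

Lemma sin_period (a : R) (n : nat) : sin (a + n%:R * (2 * pi)) = sin a.
Proof.
have -> : n%:R * (2 * pi) = (pi *+ 2) *+ n :> R by rewrite -[RHS]mulr_natl -[pi *+ 2]mulr_natl.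
exact: (periodicn (@sinD2pi R)).
Qed.

Lemma moment_period (t : R) (l : int) : moment t (l + (m.*2)%:Z) = moment t l.
Proof.
rewrite /moment; congr (_ * _); apply: eq_bigr => r _; congr (_ * _).
have key (r' : nat) : (m.*2)%:R * theta r' = r'%:R * (2 * pi).
  rewrite /theta -mul2n natrM; have := m_neq0; move: (m%:R) => M M0.
  by field.
by rewrite intrD mulrDl -[RHS](cos_period _ r) -pmulrn key.
Qed.

Lemma moment0 (l : int) : (`|l| < m.*2)%N -> moment 0 l = (l == 0)%:R.
Proof.
move=> hl; have -> : moment 0 l = moment 0 (`|l|%N%:Z).
  by case: l {hl} => n; rewrite ?abszN // NegzE momentN abszN.
rewrite -absz_eq0; move: (`|l|%N) hl => p {l} hp.
have D0 : (m.*2)%:R != 0 :> R by rewrite pnatr_eq0 double_eq0 -lt0n.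
rewrite /moment; under eq_bigr do rewrite mulr0 mul0r expR0 mul1r.
case: (posnP p) => [->|p0].
  under eq_bigr do rewrite mul0r cos0.
  by rewrite sumr_const card_ord mulVf.
set S := \sum_(_ < _) _; suff -> : S = 0 by rewrite mulr0.
pose phi : R := p%:R * (pi / m%:R).
have sphi : 0 < sin (phi / 2).
  apply: sin_gt0_pi; apply/andP; split.
    by rewrite !mulr_gt0 ?pi_gt0 ?invr_gt0 ?ltr0n.
  have -> : phi / 2 = pi * (p%:R / (m.*2)%:R).
    by rewrite /phi -mul2n natrM; have := m_neq0; move: (m%:R) => M M0; field.
  by rewrite gtr_pMr ?pi_gt0 // ltr_pdivrMr ?mul1r ?ltr_nat // ltr0n double_gt0.
(* [2 sin (phi/2) cos (r phi)] is a difference of consecutive values of [u], and the sum over the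
   full period returns to its start. The range of [l] keeps [phi / 2] strictly between 0 and pi. *)
pose u (r : nat) : R := sin (r%:R * phi - phi / 2).
have key (r : nat) : 2 * sin (phi / 2) * cos (p%:~R * theta r) = u r.+1 - u r.
  rewrite /u /theta.
  have -> : p%:~R * (r%:R * (pi / m%:R)) = r%:R * phi :> R.
    by rewrite -pmulrn /phi; ring.
  have -> : r.+1%:R * phi - phi / 2 = r%:R * phi + phi / 2 :> R.
    by rewrite -natr1; field.
  by rewrite sinB sinD; ring.
have : 2 * sin (phi / 2) * S = 0.
  rewrite mulr_sumr (eq_bigr (fun r : 'I__ => u r.+1 - u r)) => [|r _]; last exact: key.
  rewrite -(big_mkord xpredT (fun r => u r.+1 - u r)) telescope_sumr // /u.
  rewrite mul0r add0r.
  have -> : (m.*2)%:R * phi - phi / 2 = - (phi / 2) + p%:R * (2 * pi) :> R.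
    rewrite /phi -mul2n natrM; have := m_neq0; move: (m%:R) => M M0; by field.
  by rewrite sin_period subrr.
by move/eqP; rewrite !mulf_eq0 pnatr_eq0 /= gt_eqF // => /eqP.
Qed.

End moments.

Section schur_recursion.
Variables (R : realType) (m : nat).

(* The Szego recursion, written for [verblunsky n] = pi_n(0) and [pmom n t l], the integral
   of z^-l pi_n; the integral of z^-l against the reversed polynomial is
   [pmom n t (n - l)]. *)
Fixpoint schur (n : nat) (t : R) : R * (int -> R) :=
  if n is n'.+1 then
    let: (_, v) := schur n' t in
    let x := - v (-1) / v n'%:Z in
    (x, fun l => v (l - 1) + x * v (n'%:Z - l))
  else (1, moment m t).

Definition verblunsky (n : nat) (t : R) : R := (schur n t).1.
Definition pmom (n : nat) (t : R) (l : int) : R := (schur n t).2 l.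
Definition opnorm (n : nat) (t : R) : R := pmom n t n.

Lemma verblunskyS (n : nat) (t : R) : verblunsky n.+1 t = - pmom n t (-1) / opnorm n t.
Proof. by rewrite /verblunsky /opnorm /pmom /=; case: (schur n t). Qed.

Lemma pmomS (n : nat) (t : R) (l : int) :
  pmom n.+1 t l = pmom n t (l - 1) + verblunsky n.+1 t * pmom n t (n%:Z - l).
Proof. by rewrite verblunskyS /pmom /opnorm /pmom /=; case: (schur n t). Qed.

Lemma verblunsky0 (t : R) : verblunsky 0 t = 1. Proof. by []. Qed.

Lemma pmom0 (t : R) (l : int) : pmom 0 t l = moment m t l. Proof. by []. Qed.

Lemma pmom_minus1 (n : nat) (t : R) : opnorm n t != 0 ->
  pmom n t (-1) = - verblunsky n.+1 t * opnorm n t.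
Proof. by move=> h; rewrite verblunskyS; field. Qed.

(** In the inductive step only [l = 0] uses the choice of the new coefficient; for the other [l]
    both terms of the recursion vanish by induction. *)
Lemma pmom_orth (n : nat) (t : R) (l : int) :
  (forall n', (n' < n)%N -> opnorm n' t != 0) -> 0 <= l -> l < n%:Z ->
  pmom n t l = 0.
Proof.
elim: n l => [|n IH] l h l0 ln; first by lia.
have IH' l' : 0 <= l' -> l' < n%:Z -> pmom n t l' = 0.
  by apply: IH => n' h'; apply: h; lia.
rewrite pmomS; case: (eqVneq l 0) => [->|ln0].
  by rewrite sub0r subr0 pmom_minus1 ?h // -/(opnorm n t); ring.
have -> : pmom n t (l - 1) = 0 by apply: IH'; lia.
have -> : pmom n t (n%:Z - l) = 0 by apply: IH'; lia.
by rewrite mulr0 addr0.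
Qed.

Lemma opnormS (n : nat) (t : R) : opnorm n t != 0 ->
  opnorm n.+1 t = opnorm n t * (1 - verblunsky n.+1 t ^+ 2).
Proof.
move=> h; rewrite /opnorm pmomS.
have -> : (n.+1%:Z - 1 = n%:Z) by lia.
have -> : (n%:Z - n.+1%:Z = -1) by lia.
by rewrite pmom_minus1 // -/(opnorm n t); ring.
Qed.

End schur_recursion.

Section schur_flow.
Variables (R : realType) (m : nat).
Variable K : nat.
Hypothesis opnorm_neq0 : forall n (t : R), (n < K)%N -> opnorm m n t != 0.

Notation x := (verblunsky m).
Notation v := (pmom m).

(** The derivative of [v n] is a hypothesis because [pmom_derive] at [n.+1] calls this lemma at [n]:
    the two formulas share one induction. *)
Lemma verblunsky_derive_aux (n : nat) (t : R) : (n.+1 < K)%N ->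
  (forall l, is_derive t 1 (fun t => v n t l)
    (v n t (l - 1) + x n t * v n t (n%:Z - 1 - l) + x n.+1 t * v n t (n%:Z - l)
     - x n t * x n.+1 t * v n t l)) ->
  is_derive t 1 (x n.+1) ((1 - x n.+1 t ^+ 2) * (x n.+2 t - x n t)).
Proof.
move=> nK IH.
have h : opnorm m n t != 0 by apply: opnorm_neq0; lia.
have h' : opnorm m n.+1 t != 0 by apply: opnorm_neq0; lia.
rewrite (_ : x n.+1 = (fun t => - v n t (-1) / v n t n)); last first.
  by apply/funext => s; rewrite verblunskyS.
have hN := IH n; have h1 := IH (-1).
have orth l : 0 <= l -> l < n%:Z -> v n t l = 0.
  by apply: pmom_orth => n' hn'; apply: opnorm_neq0; lia.
apply: is_derive_eq; rewrite /GRing.scale /=.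
have e1 := pmom_minus1 h; have e2 := pmom_minus1 h'; have e3 := opnormS h.
rewrite pmomS e3 in e2.
have -> : v n t (-1 - 1) = - x n.+2 t * (opnorm m n t * (1 - x n.+1 t ^+ 2)) - x n.+1 t * v n t (n%:Z - -1).
  by rewrite -e2; ring.
have -> : n%:Z - 1 - -1 = n by lia.
have -> : n%:Z - 1 - n%:Z = -1 by lia.
rewrite subrr e1 -/(opnorm m n t).
(* For [n = 0] the moment of index [n - 1 = -1] is not killed by orthogonality, but [x_0 = 1] leads
   to the same final expression. *)
case: n nK IH h h' hN h1 orth e1 e2 e3 => [|n] nK IH h h' hN h1 orth e1 e2 e3.
  rewrite verblunsky0 sub0r e1 -/(opnorm m 0 t) /opnorm -/(opnorm m 0 t).
  by field.
have -> : v n.+1 t (n.+1%:Z - 1) = 0 by apply: orth; lia.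
have -> : v n.+1 t 0 = 0 by apply: orth; lia.
by field.
Qed.

(* This is the equation
   pi_n' = - (1 - x_n^2) pi_{n-1} + x_{n+1} (1 - x_n^2) pi_{n-1}^*
   integrated against z^-l, with pi_{n-1} and pi_{n-1}^* eliminated. *)
Lemma pmom_derive (n : nat) (t : R) (l : int) : (n < K)%N ->
  is_derive t 1 (fun t => v n t l)
    (v n t (l - 1) + x n t * v n t (n%:Z - 1 - l) + x n.+1 t * v n t (n%:Z - l)
     - x n t * x n.+1 t * v n t l).
Proof.
elim: n l => [|n IH] l nK.
  apply: is_derive_eq; first exact: moment_derive.
  rewrite verblunsky0 !pmom0.
  have -> : 0%:Z - 1 - l = - (l + 1) by lia.
  have -> : 0%:Z - l = - l by lia.
  by rewrite !momentN; ring.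
have {}IH l' := IH l' (ltnW nK).
rewrite (_ : (fun t => _) = (fun t => v n t (l - 1) + x n.+1 t * v n t (n%:Z - l))); last first.
  by apply/funext => s; rewrite pmomS.
apply: is_derive_eq.
  by apply: is_derive_addf => //; apply: is_derive_mulf => //; apply: verblunsky_derive_aux.
rewrite !pmomS.
have -> : n%:Z - (n.+1%:Z - 1 - l) = l by lia.
have -> : n.+1%:Z - 1 - l - 1 = n%:Z - 1 - l by lia.
have -> : n.+1%:Z - l - 1 = n%:Z - l by lia.
have -> : n%:Z - (n.+1%:Z - l) = l - 1 by lia.
have -> : n%:Z - 1 - (l - 1) = n%:Z - l by lia.
have -> : n%:Z - (l - 1) = n%:Z - l + 1 by lia.
have -> : n%:Z - 1 - (n%:Z - l) = l - 1 by lia.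
have -> : n%:Z - (n%:Z - l) = l by lia.
have -> : n%:Z - l - 1 = n%:Z - 1 - l by lia.
by ring.
Qed.

Lemma verblunsky_derive (n : nat) (t : R) : (n.+1 < K)%N ->
  is_derive t 1 (x n.+1) ((1 - x n.+1 t ^+ 2) * (x n.+2 t - x n t)).
Proof.
by move=> nK; apply: verblunsky_derive_aux => // l; apply: pmom_derive; apply: ltnW.
Qed.

Lemma opnorm_derive (n : nat) (t : R) : (n.+1 < K)%N ->
  is_derive t 1 (opnorm m n.+1) (- 2 * x n.+1 t * x n.+2 t * opnorm m n.+1 t).
Proof.
move=> nK; apply: is_derive_eq; first exact: (pmom_derive _ _ nK).
have orth l : 0 <= l -> l < n.+1%:Z -> v n.+1 t l = 0.
  by apply: pmom_orth => n' hn'; apply: opnorm_neq0; lia.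
have -> : n.+1%:Z - 1 - n.+1%:Z = -1 by lia.
rewrite subrr pmom_minus1; last exact: opnorm_neq0.
have -> : v n.+1 t (n.+1%:Z - 1) = 0 by apply: orth; lia.
have -> : v n.+1 t 0 = 0 by apply: orth; lia.
by rewrite -/(opnorm m n.+1 t); ring.
Qed.

End schur_flow.

(** * Orthogonal polynomials on the roots of unity *)

Section unit_circle.
Variable R : realType.

Definition cis (a : R) : R[i] := cos a +i* sin a.

Lemma cisD (a b : R) : cis (a + b) = cis a * cis b.
Proof. by rewrite /cis cosD sinD; apply/eqP; rewrite eq_complex /= eqxx addrC eqxx. Qed.

Lemma cis0 : cis 0 = 1.
Proof. by rewrite /cis cos0 sin0. Qed.

Lemma cisN (a : R) : cis (- a) = (cis a)^-1.
Proof.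
have h : cis (- a) * cis a = 1 by rewrite -cisD addNr cis0.
have n0 : cis a != 0 by apply/eqP => e; move: h; rewrite e mulr0 => /esym/eqP; rewrite oner_eq0.
by apply: (mulIf n0); rewrite h mulVf.
Qed.

Lemma conjc_cis (a : R) : (cis a)^* = cis (- a).
Proof. by rewrite /cis cosN sinN. Qed.

Lemma cisX (a : R) (n : nat) : cis a ^+ n = cis (n%:R * a).
Proof.
elim: n => [|n IH]; first by rewrite mul0r cis0 expr0.
by rewrite exprS IH -cisD -natr1 mulrDl mul1r addrC.
Qed.

Lemma cexp_real (a : R) : cexp a%:C = (expR a)%:C.
Proof. by rewrite /cexp /= cos0 sin0 [X in _ * X](_ : _ = 1) ?mulr1. Qed.

Lemma sqr_norm_conjc (z : R[i]) : `|z| ^+ 2 = z * z^*.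
Proof.
rewrite -add_Re2_Im2; case: z => a b /=; apply/eqP; rewrite eq_complex /=.
by rewrite mulrN opprK -!expr2 eqxx mulrN mulrC addNr eqxx.
Qed.

End unit_circle.

Section discrete_measure.
Variables (R : realType) (m : nat).
Hypothesis m_gt0 : (0 < m)%N.

Notation th := (@theta R m).

Definition mass (t : R) (r : nat) : R := expR (2 * t * cos (th r)).

Definition pairing (t : R) (p : {poly R[i]}) (l : int) : R[i] :=
  (m.*2)%:R^-1 *
  \sum_(r < m.*2) (mass t r)%:C * (cis (- (l%:~R * th r)) * p.[cis (th r)]).

Lemma mu_integralE (t : R) (f : R[i] -> R[i]) :
  mu_integral m t f = (m.*2)%:R^-1 * \sum_(r < m.*2) (mass t r)%:C * f (cis (th r)).
Proof.
rewrite /mu_integral; congr (_ * _); apply: eq_bigr => r _ /=.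
have -> : omega R m ^+ r = cis (th r).
  by rewrite /omega /cexp /= expR0 mul1r -/(cis _) cisX.
congr (_ * _); rewrite -cisN -conjc_cis addcJ /= -cexp_real; congr cexp.
by rewrite !rmorphM /= rmorph_nat; ring.
Qed.

Lemma mu_integral_pairing (t : R) (p : {poly R[i]}) (l : nat) :
  mu_integral m t (fun z => z ^- l * p.[z]) = pairing t p l.
Proof.
rewrite mu_integralE; congr (_ * _); apply: eq_bigr => r _.
by rewrite cisN cisX pmulrn.
Qed.

Lemma pairingD (t : R) (p q : {poly R[i]}) (l : int) :
  pairing t (p + q) l = pairing t p l + pairing t q l.
Proof.
rewrite /pairing -mulrDr -big_split /=; congr (_ * _); apply: eq_bigr => r _.
by rewrite hornerD !mulrDr.
Qed.

Lemma pairingZ (t : R) (c : R[i]) (p : {poly R[i]}) (l : int) :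
  pairing t (c *: p) l = c * pairing t p l.
Proof.
rewrite /pairing [RHS]mulrCA [X in _ = _ * X]mulr_sumr; congr (_ * _); apply: eq_bigr => r _ /=.
by rewrite hornerZ; ring.
Qed.

Lemma pairingX (t : R) (p : {poly R[i]}) (l : int) :
  pairing t ('X * p) l = pairing t p (l - 1).
Proof.
rewrite /pairing; congr (_ * _); apply: eq_bigr => r _ /=.
rewrite hornerM hornerX; congr (_ * _).
by rewrite mulrA -cisD; congr (cis _ * _); ring.
Qed.

Lemma pairing1 (t : R) (l : int) : pairing t 1 l = (moment m t l)%:C.
Proof.
rewrite /pairing /moment rmorphM fmorphV rmorph_nat; congr (_ * _).
under eq_bigr do rewrite hornerC mulr1.
have -> : \sum_(r < m.*2) (mass t r)%:C * cis (- (l%:~R * th r)) =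
   (\sum_(r < m.*2) mass t r * cos (l%:~R * th r)) +i*
   (\sum_(r < m.*2) - (mass t r * sin (l%:~R * th r))).
  elim/big_ind3: _ => //.
    by move=> x1 x2 x3 y1 y2 y3 -> ->.
  by move=> r _; rewrite /cis cosN sinN; simpc; rewrite ?mulrN.
congr (_ +i* _); set S := \sum_(_ < _) _.
(* The symmetry [r -> 2m - r] of the nodes keeps the mass and changes the sign of the sine. The term
   [r = 0] is null and is split off, since its image [2m] is out of range. *)
suff : S = - S by lra.
rewrite /S -sumrN.
have : (0 < m.*2)%N by rewrite double_gt0.
case E : m.*2 => [//|M] _.
rewrite !big_ord_recl /= /theta !mul0r !mulr0 sin0 mulr0 !oppr0 !add0r.
rewrite [LHS](reindex_inj rev_ord_inj); apply: eq_bigr => r _ /=.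
have er : (bump 0 (M - r.+1))%:R = M.+1%:R - (bump 0 r)%:R :> R.
  by rewrite /bump /= !add1n -natrB; [congr (_%:R); have := ltn_ord r; lia|have := ltn_ord r; lia].
have key (u : R) : M.+1%:R * (u / m%:R) = 2 * u.
  by rewrite -E -mul2n natrM; have := m_neq0 R m_gt0; move: (m%:R) => x x0; field.
rewrite /mass /theta er !mulrBl key.
have c2 (a : R) : cos (2 * pi - a) = cos a.
  by rewrite -[RHS]cosN -(cos_period (- a) 1) mul1r addrC.
have s2 (l' : int) (a : R) : sin (l'%:~R * (2 * pi - a)) = - sin (l'%:~R * a).
  rewrite mulrBr; case: l' => n.
    by rewrite -sinN -[RHS](sin_period _ n) addrC.
  by rewrite NegzE mulrNz !mulNr sinN opprK -[LHS](sin_period _ n.+1) opprK addrC addrA subrr add0r.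
by rewrite c2 s2 mulrN opprK.
Qed.

Lemma theta_diff (r s : nat) : (r < s)%N -> (s < m.*2)%N -> cis (th r) != cis (th s).
Proof.
move=> rs sm; apply/eqP => E.
have : cis (th s - th r) = 1.
  by rewrite cisD cisN E mulfV // -E; apply/eqP => e;
     have := cisD (th r) (- th r); rewrite e mul0r subrr cis0 => /eqP; rewrite oner_eq0.
move/(congr1 (@complex.Re R)) => /=; set a := th s - th r.
have a0 : 0 < sin (a / 2).
  have ea : a / 2 = pi * ((s - r)%:R / (m.*2)%:R).
    rewrite /a /theta -mul2n natrM natrB; last exact: ltnW.
    by have := m_neq0 R m_gt0; move: (m%:R) => x x0; field.
  have M0 : 0 < (m.*2)%:R :> R by rewrite ltr0n double_gt0.
  apply: sin_gt0_pi; apply/andP; split.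
    by rewrite ea !mulr_gt0 ?pi_gt0 ?invr_gt0 // ltr0n subn_gt0.
  rewrite ea gtr_pMr ?pi_gt0 // ltr_pdivrMr // mul1r ltr_nat.
  exact: leq_ltn_trans (leq_subr _ _) sm.
have -> : a = (a / 2) *+ 2 by rewrite -mulr_natr divfK // pnatr_eq0.
rewrite cos_mulr2n cos2sin2 => /eqP; apply/negP; rewrite lt_eqF //.
have : 0 < sin (a / 2) ^+ 2 by rewrite exprn_gt0.
by lra.
Qed.

Lemma points_uniq : uniq [seq cis (th r) | r <- iota 0 m.*2].
Proof.
rewrite map_inj_in_uniq ?iota_uniq // => r s; rewrite !mem_iota /= => hr hs E.
by case: (ltngtP r s) => // h; [have := theta_diff h hs|have := theta_diff h hr];
   rewrite E eqxx.
Qed.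

Definition sqnorm (t : R) (p : {poly R[i]}) : R[i] :=
  (m.*2)%:R^-1 * \sum_(r < m.*2) (mass t r)%:C * `|p.[cis (th r)]| ^+ 2.

Lemma sqnorm_pairing (t : R) (p : {poly R[i]}) :
  sqnorm t p = \sum_(b < size p) (p`_b)^* * pairing t p b.
Proof.
rewrite /sqnorm /pairing.
have -> : \sum_(b < size p) (p`_b)^* * ((m.*2)%:R^-1 *
     \sum_(r < m.*2) (mass t r)%:C * (cis (- ((b : nat)%:~R * th r)) * p.[cis (th r)])) =
  (m.*2)%:R^-1 * \sum_(b < size p) \sum_(r < m.*2) (p`_b)^* *
     ((mass t r)%:C * (cis (- ((b : nat)%:~R * th r)) * p.[cis (th r)])).
  by rewrite mulr_sumr; apply: eq_bigr => b _; rewrite mulrCA; congr (_ * _); rewrite mulr_sumr.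
congr (_ * _); rewrite exchange_big /=; apply: eq_bigr => r _.
have -> : `|p.[cis (th r)]| ^+ 2 =
    p.[cis (th r)] * \sum_(b < size p) (p`_b)^* * cis (- ((b : nat)%:~R * th r)).
  rewrite sqr_norm_conjc; congr (_ * _); rewrite horner_coef rmorph_sum.
  by apply: eq_bigr => b _; rewrite cisX rmorphM [X in _ * X = _]conjc_cis pmulrn.
by rewrite !mulr_sumr; apply: eq_bigr => b _; ring.
Qed.

Lemma sqnorm_ge0 (t : R) (p : {poly R[i]}) : 0 <= sqnorm t p.
Proof.
rewrite mulr_ge0 ?invr_ge0 ?ler0n // sumr_ge0 // => r _.
by rewrite mulr_ge0 ?exprn_ge0 // ler0c expR_ge0.
Qed.

(** All masses are positive, so [p] vanishes at [2m] distinct points, more than its degree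
    allows. *)
Lemma sqnorm_eq0 (t : R) (p : {poly R[i]}) :
  (size p <= m.*2)%N -> sqnorm t p = 0 -> p = 0.
Proof.
move=> sp /eqP; rewrite mulf_eq0 invr_eq0 pnatr_eq0 double_eq0 -leqn0 leqNgt m_gt0 /=.
rewrite psumr_eq0 => [/allP h|r _]; last first.
  by rewrite mulr_ge0 ?exprn_ge0 // ler0c expR_ge0.
apply/eqP/negPn/negP => p0.
have : (size [seq cis (th r) | r <- iota 0 m.*2] < size p)%N.
  apply: max_poly_roots => //; last exact: points_uniq.
  apply/allP => z /mapP[r]; rewrite mem_iota /= => hr ->.
  have := h (Ordinal hr); rewrite mem_index_enum => /(_ isT) /=.
  rewrite mulf_eq0 expf_eq0 /= normr_eq0 => /orP[/eqP/complexI/eqP|//].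
  by rewrite gt_eqF // expR_gt0.
by rewrite size_map size_iota ltnNge sp.
Qed.

(** The pair of pi_n and its reversed polynomial z^n pi_n(1/z). The coefficients are real because
    the moments are. *)
Fixpoint szego (n : nat) (t : R) : {poly R} * {poly R} :=
  if n is n'.+1 then
    let: (p, q) := szego n' t in
    ('X * p + verblunsky m n t *: q, q + verblunsky m n t *: ('X * p))
  else (1, 1).

Lemma szego_spec (n : nat) (t : R) :
  [/\ (szego n t).1 \is monic, size (szego n t).1 = n.+1,
      (size (szego n t).2 <= n.+1)%N, (szego n t).1`_0 = verblunsky m n t &
      (szego n t).2`_0 = 1].
Proof.
elim: n => [|n]; first by rewrite /= monic1 size_poly1 coef1.
rewrite [szego n.+1 t]/=; case: (szego n t) => p q /= [h1 h2 h3 h4 h5].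
have sX : size ('X * p) = n.+2 by rewrite mulrC size_mulX -?size_poly_eq0 h2.
have sZ : (size (verblunsky m n.+1 t *: q)%R < size ('X * p)%R)%N.
  by rewrite sX ltnS; apply: leq_trans (size_scale_leq _ _) h3.
split.
- by rewrite monicE lead_coefDl // mulrC lead_coefMX -monicE.
- by rewrite size_polyDl // sX.
- apply: leq_trans (size_polyD _ _) _; rewrite geq_max (leq_trans h3) //=.
  by apply: leq_trans (size_scale_leq _ _) _; rewrite sX.
- by rewrite coefD coefXM eqxx add0r coefZ h5 mulr1.
- by rewrite coefD coefZ coefXM eqxx mulr0 addr0.
Qed.

Notation toC := (map_poly (real_complex R)).

Lemma szego_pairing (n : nat) (t : R) (l : int) :
  pairing t (toC (szego n t).1) l = (pmom m n t l)%:C /\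
  pairing t (toC (szego n t).2) l = (pmom m n t (n%:Z - l))%:C.
Proof.
elim: n l => [|n IH] l.
  by rewrite /= rmorph1 pairing1 !pmom0 sub0r momentN.
move: IH; rewrite [szego n.+1 t]/=; case: (szego n t) => p q /= IH.
have [h1 h4] := IH (l - 1); have [_ h2] := IH l.
rewrite !rmorphD /= !map_polyZ !rmorphM /= map_polyX !pairingD !pairingZ !pairingX h1 h2.
rewrite !pmomS.
have -> : n.+1%:Z - l - 1 = n%:Z - l by lia.
have -> : n%:Z - (n.+1%:Z - l) = l - 1 by lia.
by split; rewrite rmorphD rmorphM.
Qed.

Lemma coef_toC (p : {poly R}) (i : nat) : (toC p)`_i = (p`_i)%:C.
Proof. exact: coef_map. Qed.

Lemma opnorm_sqnorm (n : nat) (t : R) :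
  (forall n', (n' < n)%N -> opnorm m n' t != 0) ->
  (opnorm m n t)%:C = sqnorm t (toC (szego n t).1).
Proof.
move=> h; have [h1 h2 _ _ _] := szego_spec n t.
rewrite sqnorm_pairing size_map_poly h2 big_ord_recr /= big1 ?add0r => [|b _]; last first.
  by rewrite (szego_pairing n t b).1 (pmom_orth h) ?mulr0 ?rmorph0 //; have := ltn_ord b; lia.
rewrite coef_toC (szego_pairing n t n).1.
have := monicP h1; rewrite lead_coefE h2 /= => ->.
rewrite [X in _ = X * _](_ : _ = 1) ?mul1r //.
by apply/eqP; rewrite eq_complex /= oppr0 !eqxx.
Qed.

(** Nonzero lower norms give orthogonality, which turns [opnorm m n t] into the squared norm of a
    monic polynomial of degree [n < 2m]. At [n = 2m] positivity fails: pi_n = z^(2m) - 1 vanishes at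
    every node. *)
Lemma opnorm_gt0 (n : nat) (t : R) : (n < m.*2)%N -> 0 < opnorm m n t.
Proof.
elim/ltn_ind: n => n IH hn; have [h1 h2 _ _ _] := szego_spec n t.
have E : (opnorm m n t)%:C = sqnorm t (toC (szego n t).1).
  by apply: opnorm_sqnorm => n' h; rewrite gt_eqF // IH // (ltn_trans h).
rewrite -ltcR E lt_def sqnorm_ge0 andbT; apply/eqP => /sqnorm_eq0.
rewrite size_map_poly h2 => /(_ hn)/eqP.
by rewrite map_poly_eq0 -size_poly_eq0 h2.
Qed.

Lemma is_orthopoly_unique (n : nat) (t : R) (p q : {poly R[i]}) : (n <= m.*2)%N ->
  is_orthopoly n m t p -> is_orthopoly n m t q -> p = q.
Proof.
move=> hn [mp sp op] [mq sq oq]; apply/eqP; rewrite -subr_eq0; apply/eqP.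
have sd : (size (p - q)%R <= n)%N.
  apply/leq_sizeP => i; rewrite leq_eqVlt => /orP[/eqP<-|hi].
    have := monicP mp; have := monicP mq; rewrite !lead_coefE sp sq /= coefB => -> ->.
    by rewrite subrr.
  by rewrite coefB !nth_default ?subrr // ?sp ?sq.
apply: (@sqnorm_eq0 t); first exact: leq_trans hn.
rewrite sqnorm_pairing big1 // => b _.
have hb : (b < n)%N by apply: leq_trans sd.
suff -> : pairing t (p - q) b = 0 by rewrite mulr0.
move: (nat_of_ord b) hb => c hc.
by rewrite -[- q]scaleN1r pairingD pairingZ -!mu_integral_pairing op // oq // mulr0 addr0.
Qed.

(** The recursion divides only by norms of index below [n], so [n = 2m] is included; pi_{2j+2}
    requires it when [k = 0]. *)
Lemma orthopolyE (n : nat) (t : R) : (n <= m.*2)%N ->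
  orthopoly n m t = toC (szego n t).1.
Proof.
move=> hn; have [h1 h2 _ _ _] := szego_spec n t.
have O : is_orthopoly n m t (toC (szego n t).1).
  split; [by rewrite map_monic|by rewrite size_map_poly|].
  move=> l hl; rewrite mu_integral_pairing (szego_pairing n t l).1.
  rewrite pmom_orth ?rmorph0 // => n' hn'.
  by rewrite gt_eqF // opnorm_gt0 // (leq_trans hn').
by apply: xget_unique => // q hq; apply: (is_orthopoly_unique hn hq O).
Qed.

Lemma orthopoly_at0 (n : nat) (t : R) : (n <= m.*2)%N ->
  (orthopoly n m t).[0] = (verblunsky m n t)%:C.
Proof.
move=> hn; rewrite orthopolyE // horner_coef0 coef_toC.
by have [_ _ _ -> _] := szego_spec n t.
Qed.

Lemma pmom_coef (n : nat) (t : R) (l : int) :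
  pmom m n t l = \sum_(b < n.+1) (szego n t).1`_b * moment m t (l - b%:Z).
Proof.
have [_ h2 _ _ _] := szego_spec n t.
apply: (@complexI R); rewrite -(szego_pairing n t l).1 rmorph_sum.
rewrite -h2 -[X in pairing _ (toC X) _]coefK poly_def rmorph_sum /=.
have pX i : pairing t ('X^i) l = (moment m t (l - i%:Z))%:C.
  elim: i l => [|i IH] l; first by rewrite expr0 pairing1 subr0.
  by rewrite exprS pairingX IH; congr (moment _ _ _)%:C; lia.
elim/big_ind2: _ => [|x1 x2 y1 y2 <- <-|i _].
- by rewrite -(scale0r 1) pairingZ mul0r.
- by rewrite pairingD.
- by rewrite map_polyZ map_polyXn pairingZ pX -rmorphM.
Qed.

End discrete_measure.

(** * The determinant of the antisymmetrised kernel *)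

Section symplectic_determinant.
Variables (R : realType) (m : nat).
Hypothesis m_gt0 : (0 < m)%N.

Notation x := (@verblunsky R m).
Notation h := (@moment R m).
Notation P n t := (szego m n t).1.

(* The entries of exp(tA), A being the adjacency matrix of the path 1, ..., m - 1. *)
Definition kern (t : R) (a b : int) : R := h t (a - b) - h t (a + b).

Definition kern_mx (j : nat) (t : R) : 'M[R]_j :=
  \matrix_(i, l) kern t (rev_ord i).+1%:Z (rev_ord l).+1%:Z.

(* The pairing of z^-s pi_{2s}(z) - z^s pi_{2s}(1/z) with z^l. *)
Lemma pmom_antisym (s : nat) (l : int) (t : R) :
  pmom m s.*2 t (s%:Z + l) - pmom m s.*2 t (s%:Z - l) =
  \sum_(a < s) ((P s.*2 t)`_(s + a.+1) - (P s.*2 t)`_(s - a.+1)) * kern t a.+1%:Z l.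
Proof.
pose F (b : nat) := (P s.*2 t)`_b * (h t (s%:Z + l - b%:Z) - h t (s%:Z - l - b%:Z)).
have -> : pmom m s.*2 t (s%:Z + l) - pmom m s.*2 t (s%:Z - l) = \sum_(b < (s + s.+1)%N) F b.
  rewrite !pmom_coef // -sumrB addnS addnn; apply: eq_bigr => b _.
  by rewrite /F mulrBr.
rewrite big_split_ord big_ord_recl /= addn0.
have -> : F s = 0.
  rewrite /F; have -> : s%:Z + l - s%:Z = l by lia.
  have -> : s%:Z - l - s%:Z = - l by lia.
  by rewrite momentN subrr mulr0.
rewrite add0r (reindex_inj rev_ord_inj) -big_split; apply: eq_bigr => a _ /=.
have sa : (s - a.+1)%:Z = s%:Z - a.+1%:Z by have := ltn_ord a; lia.
rewrite /F /kern /bump /= add1n sa PoszD.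
have -> : s%:Z + l - (s%:Z - a.+1%:Z) = a.+1%:Z + l by lia.
have -> : s%:Z - l - (s%:Z - a.+1%:Z) = a.+1%:Z - l by lia.
have -> : s%:Z + l - (s%:Z + a.+1%:Z) = - (a.+1%:Z - l) by lia.
have -> : s%:Z - l - (s%:Z + a.+1%:Z) = - (a.+1%:Z + l) by lia.
rewrite !momentN; ring.
Qed.

Lemma det_kern_mx (j : nat) (t : R) : (j < m)%N ->
  \det (kern_mx j t) * \prod_(i < j) (1 - x i.+1.*2 t) =
  \prod_(i < j) opnorm m i.+1.*2 t.
Proof.
move=> jm.
have nz n : (n < m.*2)%N -> opnorm m n t != 0 by move=> hn; rewrite gt_eqF // opnorm_gt0.
(* The row of [C] for [s] holds the coefficients of the antisymmetrised z^-s pi_{2s} on the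
   functions z^c - z^-c, with [s] and [c] numbered downwards as in [kern_mx]. *)
pose C : 'M[R]_j := \matrix_(i, a)
  let s := (rev_ord i).+1 in let c := (rev_ord a).+1 in
  if (c <= s)%N then (P s.*2 t)`_(s + c) - (P s.*2 t)`_(s - c) else 0.
have CD i l : (C *m kern_mx j t) i l =
    pmom m (rev_ord i).+1.*2 t ((rev_ord i).+1%:Z + (rev_ord l).+1%:Z) -
    pmom m (rev_ord i).+1.*2 t ((rev_ord i).+1%:Z - (rev_ord l).+1%:Z).
  rewrite pmom_antisym mxE (reindex_inj rev_ord_inj) /=.
  set s := (j - i.+1).+1; set l' := (j - l.+1).+1%:Z.
  have sj : (s <= j)%N by rewrite /s; have := ltn_ord i; lia.
  rewrite (big_ord_widen j (fun a => ((P s.*2 t)`_(s + a.+1) -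
     (P s.*2 t)`_(s - a.+1)) * kern t a.+1%:Z l') sj) [RHS]big_mkcond.
  apply: eq_bigr => a _; rewrite !mxE rev_ordK -/s -/l'.
  by rewrite /=; case: ifP; rewrite ?mul0r.
have detC : \det C = \prod_(i < j) (1 - x i.+1.*2 t).
  rewrite -det_tr det_trig; last first.
    apply/is_trig_mxP => i a ia; rewrite !mxE /=; case: ifP => // h.
    by have := ltn_ord a; have := ltn_ord i; lia.
  rewrite (reindex_inj rev_ord_inj); apply: eq_bigr => i _.
  (* At [c = s] the coefficients of index [2s] and 0 remain: the leading one, 1, and the constant
     one, x_{2s}. *)
  rewrite !mxE rev_ordK [LHS]/= leqnn subnn addnn.
  have [h1 h2 _ -> _] := szego_spec m i.+1.*2 t.
  by have := monicP h1; rewrite lead_coefE h2 /= => ->.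
have detCD : \det (C *m kern_mx j t) = \prod_(i < j) opnorm m i.+1.*2 t.
  rewrite det_trig; last first.
    (* Above the diagonal both indices, [s] plus and minus a smaller positive number, lie in the
       range killed by orthogonality. On the diagonal only index 0 does, and N_{2s} remains. *)
    apply/is_trig_mxP => i l il; rewrite CD /=.
    have hi := ltn_ord i; have hl := ltn_ord l.
    have o (q : int) : 0 <= q -> q < ((j - i.+1).+1.*2)%:Z ->
        pmom m (j - i.+1).+1.*2 t q = 0.
      by apply: pmom_orth => n' hn'; apply: nz; lia.
    by rewrite !o ?subrr //; lia.
  rewrite [LHS](reindex_inj rev_ord_inj); apply: eq_bigr => i _.
  rewrite CD rev_ordK subrr [X in _ - X]pmom_orth ?subr0 //.
    by rewrite /opnorm; congr pmom; lia.
  by move=> n' hn'; apply: nz; have := ltn_ord i; lia.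
by rewrite -detC -detCD det_mulmx mulrC.
Qed.

(** [1 - x^2] is a ratio of consecutive norms, both positive in this range. *)
Lemma verblunsky_lt1 (n : nat) (t : R) : (n.+1 < m.*2)%N -> 0 < 1 - x n.+1 t.
Proof.
move=> hn; have h0 : 0 < opnorm m n t by apply: opnorm_gt0 => //; apply: ltnW.
have := @opnorm_gt0 R m m_gt0 n.+1 t hn; rewrite opnormS ?gt_eqF // pmulr_rgt0 //.
nra.
Qed.

Lemma det_kern_mx_gt0 (j : nat) (t : R) : (j < m)%N -> 0 < \det (kern_mx j t).
Proof.
move=> jm; have hp : 0 < \prod_(i < j) (1 - x i.+1.*2 t).
  by apply: prodr_gt0 => i _; rewrite doubleS; apply: verblunsky_lt1; have := ltn_ord i; lia.
rewrite -(pmulr_lgt0 _ hp) det_kern_mx //.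
by apply: prodr_gt0 => i _; apply: opnorm_gt0 => //; have := ltn_ord i; lia.
Qed.

Lemma ln_prod (n : nat) (F : 'I_n -> R) : (forall i, 0 < F i) ->
  ln (\prod_i F i) = \sum_i ln (F i).
Proof.
move=> h; suff [] : 0 < \prod_i F i /\ ln (\prod_i F i) = \sum_i ln (F i) by [].
elim/big_ind2: _ => [|u v w z [h1 <-] [h2 <-]|i _]; first by rewrite ln1.
  by rewrite mulr_gt0 // lnM.
by split.
Qed.

Lemma ln_det_kern_mx (j : nat) (t : R) : (j < m)%N ->
  ln (\det (kern_mx j t)) =
  \sum_(i < j) (ln (opnorm m i.+1.*2 t) - ln (1 - x i.+1.*2 t)).
Proof.
move=> jm; rewrite sumrB -!ln_prod => [|i|i]; last 2 first.
- by rewrite doubleS; apply: verblunsky_lt1; have := ltn_ord i; lia.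
- by apply: opnorm_gt0 => //; have := ltn_ord i; lia.
rewrite -det_kern_mx // lnM ?addrK // ?posrE ?det_kern_mx_gt0 //.
by apply: prodr_gt0 => i _; rewrite doubleS; apply: verblunsky_lt1; have := ltn_ord i; lia.
Qed.

Lemma verblunsky_derive_circle (n : nat) (t : R) : (n.+1 < m.*2)%N ->
  is_derive t 1 (x n.+1) ((1 - x n.+1 t ^+ 2) * (x n.+2 t - x n t)).
Proof. by apply: verblunsky_derive => k s hk; rewrite gt_eqF // opnorm_gt0. Qed.

Lemma ln_det_derive (j : nat) (t : R) : (j < m)%N ->
  is_derive t 1 (fun s => ln (\det (kern_mx j s)))
    (x j.*2.+1 t - \sum_(n < j.*2.+1) x n t * x n.+1 t).
Proof.
move=> jm.
rewrite (_ : (fun s => _) = (fun s =>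
   \sum_(i < j) (ln (opnorm m i.+1.*2 s) - ln (1 - x i.+1.*2 s)))); last first.
  by apply/funext => s; rewrite ln_det_kern_mx.
(* With [s = i + 1], this is [-2 x_{2s} x_{2s+1}] from the logarithm of N_{2s} plus
   [(1 + x_{2s}) (x_{2s+1} - x_{2s-1})] from that of [1 - x_{2s}]. *)
pose d (i : 'I_j) : R := x i.+1.*2.+1 t * (1 - x i.+1.*2 t) - x i.*2.+1 t * (1 + x i.+1.*2 t).
have H : is_derive t 1 (fun s => \sum_(i < j) (ln (opnorm m i.+1.*2 s) - ln (1 - x i.+1.*2 s)))
   (\sum_i d i).
  apply: (@is_derive_sumf R 'I_j _ _ (fun i s => ln (opnorm m i.+1.*2 s) - ln (1 - x i.+1.*2 s))).
  move=> i _; rewrite /d !doubleS; have hi := ltn_ord i.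
  have hn : (i.*2.+2 < m.*2)%N by lia.
  have N0 : 0 < opnorm m i.*2.+2 t by apply: opnorm_gt0.
  have X0 : 0 < 1 - x i.*2.+2 t by apply: verblunsky_lt1.
  have dN : is_derive t 1 (opnorm m i.*2.+2) (- 2 * x i.*2.+2 t * x i.*2.+3 t * opnorm m i.*2.+2 t).
    by apply: (@opnorm_derive R m m.*2) => // k s hk; rewrite gt_eqF // opnorm_gt0.
  have dX := verblunsky_derive_circle t hn.
  apply: is_derive_eq.
    apply: is_derive_subf.
      exact: (is_derive_compf (is_derive1_ln N0) dN).
    exact: (@is_derive_compf R (@ln R) (fun s => 1 - x i.*2.+2 s) t _ _ (is_derive1_ln X0)
      (is_derive_subf (is_derive_cstf t 1) dX)).
  have := lt0r_neq0 N0; have := lt0r_neq0 X0.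
  move: (opnorm _ _ _) => N; move: (x _ t) (x _ t) (x _ t) => u v w u1 N1.
  by field; apply/andP.
apply: (is_derive_eq H).
rewrite /d {d H}; elim: j jm => [|j IH] jm.
  by rewrite big_ord0 big_ord1 verblunsky0 mul1r subrr.
rewrite big_ord_recr /= IH; last exact: ltnW.
by rewrite ?doubleS !big_ord_recr /= ?doubleS; ring.
Qed.

Lemma verblunsky_sum_derive (j : nat) (t : R) : (j < m)%N ->
  is_derive t 1 (fun s => - (\sum_(n < j.*2.+1) x n s * x n.+1 s) - s)
    (- (x j.*2 t * x j.*2.+2 t + x j.*2.+1 t ^+ 2) +
     x j.*2 t * x j.*2.+2 t * x j.*2.+1 t ^+ 2).
Proof.
move=> jm.
(* Chosen so that the derivative of [x_n x_{n+1}] is [u n.+1 - u n]. At [n = 0] the default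
   [n.-1 = 0] is harmless because [1 - x_0^2 = 0]; thus [u 0 = 1], which the derivative of [- s]
   cancels. *)
pose F (n : nat) : R := (1 - x n t ^+ 2) * x n.+1 t * x n.-1 t.
pose u (n : nat) : R := x n t ^+ 2 + F n.
have du (n : nat) : (n.+1 < m.*2)%N ->
   is_derive t 1 (fun s => x n s * x n.+1 s) (u n.+1 - u n).
  case: n => [|n] hn.
    apply: is_derive_eq; first exact: (is_derive_mulf (is_derive_cstf t 1) (verblunsky_derive_circle t hn)).
    by rewrite /u /F !verblunsky0; ring.
  apply: is_derive_eq.
    exact: (is_derive_mulf (verblunsky_derive_circle t (ltnW hn)) (verblunsky_derive_circle t hn)).
  by rewrite /u /F /=; ring.
apply: is_derive_eq.
  apply: (is_derive_subf (is_derive_oppf _) (is_derive_id t 1)).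
  apply: (@is_derive_sumf R 'I_(j.*2.+1) _ _ (fun n s => x n s * x n.+1 s)
     (fun n => u n.+1 - u n)).
  by move=> n _; apply: du; have := ltn_ord n; lia.
rewrite -(big_mkord xpredT (fun n => u n.+1 - u n)) telescope_sumr //.
by rewrite /u /F /= verblunsky0; ring.
Qed.

Lemma schur0 (n : nat) : (n < m.*2)%N ->
  ((0 < n)%N -> x n 0 = 0) /\ forall l, pmom m n 0 l = h 0 (l - n%:Z).
Proof.
elim: n => [|n IH] hn; first by split=> // l; rewrite subr0.
have [_ h2] := IH (ltnW hn).
have x0 : x n.+1 0 = 0.
  rewrite verblunskyS h2 moment0 //; last by lia.
  have -> : (-1 - n%:Z == 0) = false by apply/eqP; lia.
  by rewrite oppr0 mul0r.
split=> // l; rewrite pmomS x0 mul0r addr0 h2; congr moment; lia.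
Qed.

Lemma verblunsky_sum0 (j : nat) : (j < m)%N ->
  - (\sum_(n < j.*2.+1) x n 0 * x n.+1 0) - 0 = 0.
Proof.
move=> jm; rewrite big1 ?oppr0 ?addr0 // => n _.
by rewrite ((@schur0 n.+1 _).1 isT) ?mulr0 //; have := ltn_ord n; lia.
Qed.

Lemma kern0 (a b : nat) : (0 < a < m)%N -> (0 < b < m)%N ->
  kern 0 a%:Z b%:Z = (a == b)%:R.
Proof.
move=> ha hb; rewrite /kern !moment0 //; try lia.
have -> : (a%:Z + b%:Z == 0) = false by apply/eqP; lia.
by rewrite subr0 subr_eq0.
Qed.

Lemma kern_mx0 (j : nat) : (j < m)%N -> kern_mx j 0 = 1%:M.
Proof.
move=> jm; apply/matrixP => i l; rewrite !mxE kern0; last 2 first.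
- by have := ltn_ord i => /=; lia.
- by have := ltn_ord l => /=; lia.
by rewrite eqSS -(inj_eq (@rev_ord_inj j)).
Qed.

Lemma kern_derive (a b : int) (t : R) :
  is_derive t 1 (fun s => kern s a b) (kern t (a + 1) b + kern t (a - 1) b).
Proof.
apply: is_derive_eq; first exact: (is_derive_subf (moment_derive _ _ _) (moment_derive _ _ _)).
rewrite /kern.
have -> : a + 1 - b = a - b + 1 by lia.
have -> : a - 1 - b = a - b - 1 by lia.
have -> : a + 1 + b = a + b + 1 by lia.
have -> : a - 1 + b = a + b - 1 by lia.
by ring.
Qed.

Lemma kern_lo (b : int) (t : R) : kern t 0 b = 0.
Proof. by rewrite /kern sub0r add0r momentN subrr. Qed.

(** The moments are even and [2m]-periodic, so they agree at [m - b] and [m + b]. Together with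
    [kern_lo] this makes 0 and [m] absorbing walls. *)
Lemma kern_hi (b : int) (t : R) : kern t m%:Z b = 0.
Proof.
rewrite /kern -(momentN m t (m%:Z + b)) -(moment_period m_gt0 t (- _)).
have -> : - (m%:Z + b) + (m.*2)%:Z = m%:Z - b by lia.
by rewrite subrr.
Qed.

End symplectic_determinant.

(** * Determinants indexed by shapes *)

Section shape_moves.
Variables k j : nat.
Notation shape := {ffun 'I_j -> 'I_k.+1}.

Lemma decr_up (a : shape) (i : 'I_j) : decr a -> addable a i -> decr (up a i).
Proof.
move=> /decrP da hi; apply/decrP => i1 i2 h12; rewrite !upE //.
have := da _ _ h12; case: (altP (i2 =P i)) => [e|_]; last by case: (i1 == i); lia.
case: (altP (i1 =P i)) => [->|ni1]; first by rewrite e; lia.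
move=> _; rewrite addn0 addn1 {}e in h12 *.
have i0 : (0 < i)%N by case: (posnP i) => // e0; case/eqP: ni1; apply: val_inj => /=; lia.
have hp : (i.-1 < j)%N by have := ltn_ord i; lia.
case/andP: hi => _ /forallP/(_ (Ordinal hp)); rewrite /= prednK // eqxx /= => h.
apply: leq_trans h (da _ _ _) => /=.
have : i1 != i :> nat by apply: contra ni1 => /eqP e; apply/eqP/val_inj.
by lia.
Qed.

Lemma decr_down (a : shape) (i : 'I_j) : decr a -> removable a i -> decr (down a i).
Proof.
move=> /decrP da /andP[h0 /forallP hi]; apply/decrP => i1 i2 h12; rewrite !downE.
have := da _ _ h12; case: (altP (i1 =P i)) => [e|_]; last by case: (i2 == i); lia.
case: (altP (i2 =P i)) => [->|ni2]; first by rewrite e; lia.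
move=> _; rewrite {}e in h12 *.
have ne : i2 != i :> nat by apply: contra ni2 => /eqP e; apply/eqP/val_inj.
have hp : (i.+1 < j)%N by have := ltn_ord i2; lia.
have := hi (Ordinal hp); rewrite /= eqxx /= => h.
by have := da (Ordinal hp) i2; rewrite /=; lia.
Qed.

End shape_moves.

Section determinants_of_shapes.
Variables (R : realType) (k j : nat).
Let m := (j + k + 1)%N.
Notation shape := {ffun 'I_j -> 'I_k.+1}.

Lemma sites_gt0 : (0 < m)%N. Proof. by rewrite /m addn1. Qed.

(** The minor for particles travelling from [p] to the packed positions [j, ..., 1]. Arbitrary
    integer positions are allowed, so that a step onto a wall or onto another particle can be
    written down and shown to give 0. *)
Definition pos_det (p : 'I_j -> int) (t : R) : R :=
  \det (\matrix_(i, l) kern m t (p i) (rev_ord l).+1%:Z).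

(** The staircase [j, ..., 1] added to the column lengths makes the positions of a [decr] shape
    strictly decreasing. *)
Definition shape_pos (a : shape) (i : 'I_j) : int := (a i + (rev_ord i).+1)%:Z.

Definition shift (p : 'I_j -> int) (d : int) (i i' : 'I_j) : int :=
  p i' + (if i' == i then d else 0).

Lemma pos_det_derive (p : 'I_j -> int) (t : R) :
  is_derive t 1 (pos_det p)
    (\sum_i (pos_det (shift p 1 i) t + pos_det (shift p (-1) i) t)).
Proof.
have H := @det_derive R j (fun i l s => kern m s (p i) (rev_ord l).+1%:Z) _ t
  (fun i l => kern_derive sites_gt0 (p i) (rev_ord l).+1%:Z t).
apply: (is_derive_eq H); apply: eq_bigr => i _.
rewrite -[pos_det (shift p 1 i) t]mul1r -[pos_det (shift p (-1) i) t]mul1r.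
apply: (@determinant_multilinear _ _ _ _ _ i 1 1).
- by apply/rowP => l; rewrite !mxE /shift eqxx !mul1r.
- by apply/matrixP => i' l; rewrite !mxE /shift eq_sym (negbTE (neq_lift _ _)) addr0.
- by apply/matrixP => i' l; rewrite !mxE /shift eq_sym (negbTE (neq_lift _ _)) addr0.
Qed.

Lemma pos_det_eq0 (p : 'I_j -> int) (t : R) (i : 'I_j) :
  (forall l, kern m t (p i) l = 0) -> pos_det p t = 0.
Proof.
move=> h; rewrite /pos_det (expand_det_row _ i) big1 // => l _.
by rewrite mxE h mul0r.
Qed.

Lemma pos_det_same (p : 'I_j -> int) (t : R) (i i' : 'I_j) :
  i != i' -> p i = p i' -> pos_det p t = 0.
Proof.
move=> ni e; apply: (determinant_alternate ni) => l.
by rewrite !mxE e.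
Qed.

Lemma pos_det_ext (p q : 'I_j -> int) (t : R) : p =1 q -> pos_det p t = pos_det q t.
Proof. by move=> h; congr (\det _); apply/matrixP => i l; rewrite !mxE h. Qed.

(** A forbidden step puts two particles on one site, giving equal rows, or the first particle on the
    wall [m], giving a null row. *)
Lemma pos_det_up (a : shape) (i : 'I_j) (t : R) : decr a ->
  pos_det (shift (shape_pos a) 1 i) t =
  if addable a i then pos_det (shape_pos (up a i)) t else 0.
Proof.
move=> /decrP da; case: ifPn => [hi|].
  apply: pos_det_ext => i'; rewrite /shift /shape_pos upE //.
  by case: (i' == i); lia.
rewrite negb_and -leqNgt => hi.
have same (i' : 'I_j) : i'.+1 = i -> (a i' <= a i)%N ->
    pos_det (shift (shape_pos a) 1 i) t = 0.
  move=> e le; have ni : (i' == i) = false by apply/eqP => e'; rewrite e' in e; lia.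
  apply: (@pos_det_same _ t i' i); rewrite ?ni //.
  have := da i' i; rewrite /shift ni eqxx /shape_pos /=; have := ltn_ord i; lia.
case/orP: hi => [hk|]; last first.
  by rewrite negb_forall => /existsP[i']; rewrite negb_imply -leqNgt => /andP[/eqP e]; apply: same.
have ak : a i = k :> nat by have := ltn_ord (a i); lia.
case: (posnP i) => i0.
  apply: (@pos_det_eq0 _ t i) => l; rewrite /shift eqxx /shape_pos /=.
  have -> : (a i + (j - i.+1).+1)%:Z + 1 = m%:Z by have := ltn_ord i; rewrite /m; lia.
  exact: kern_hi sites_gt0 _ _.
(* A full column other than the first is preceded by a full column, so the step is a collision. *)
have hp : (i.-1 < j)%N by have := ltn_ord i; lia.
apply: (same (Ordinal hp)); rewrite /= ?prednK // ak.
by have := ltn_ord (a (Ordinal hp)).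
Qed.

Lemma pos_det_down (a : shape) (i : 'I_j) (t : R) : decr a ->
  pos_det (shift (shape_pos a) (-1) i) t =
  if removable a i then pos_det (shape_pos (down a i)) t else 0.
Proof.
move=> /decrP da; case: ifPn => [/andP[hi _]|].
  apply: pos_det_ext => i'; rewrite /shift /shape_pos downE.
  by case: (altP (i' =P i)) => [->|_]; lia.
rewrite negb_and -leqNgt leqn0 => hi.
have same (i' : 'I_j) : i' = i.+1 :> nat -> (a i <= a i')%N ->
    pos_det (shift (shape_pos a) (-1) i) t = 0.
  move=> e le; have ni : (i' == i) = false by apply/eqP => e'; rewrite e' in e; lia.
  apply: (@pos_det_same _ t i' i); rewrite ?ni //.
  have := da i i'; rewrite /shift ni eqxx /shape_pos /=; have := ltn_ord i'; lia.
case/orP: hi => [/eqP hk|]; last first.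
  by rewrite negb_forall => /existsP[i']; rewrite negb_imply -leqNgt => /andP[/eqP e]; apply: same.
case: (ltnP i.+1 j) => hj; first by apply: (same (Ordinal hj)) => //; rewrite hk.
apply: (@pos_det_eq0 _ t i) => l; rewrite /shift eqxx /shape_pos /= hk.
have -> : (0 + (j - i.+1).+1)%:Z + -1 = 0 by lia.
exact: kern_lo.
Qed.

Notation empty := (shape_of k j [::]).

Lemma emptyE (i : 'I_j) : empty i = 0%N :> nat.
Proof. by rewrite shape_ofE /cols (eq_count (a2 := pred0)) ?count_pred0. Qed.

Lemma decr_empty : decr empty.
Proof. by apply/decrP => i i' _; rewrite !emptyE. Qed.

Lemma pos_det_empty (t : R) : pos_det (shape_pos empty) t = \det (kern_mx m j t).
Proof. by congr (\det _); apply/matrixP => i l; rewrite !mxE /shape_pos emptyE. Qed.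

Lemma pos_det0 (a : shape) : decr a ->
  pos_det (shape_pos a) 0 = (a == empty)%:R.
Proof.
move=> /decrP da; case: (altP (a =P empty)) => [->|na].
  by rewrite pos_det_empty kern_mx0 ?det1 ?sites_gt0 // /m; lia.
have [i hi] : exists i, (0 < a i)%N.
  apply/existsP; apply: contraR na; rewrite negb_exists => /forallP h.
  apply/eqP/ffunP => i; apply: val_inj => /=; rewrite emptyE.
  by apply/eqP; rewrite -leqn0 leqNgt.
have j0 : (0 < j)%N by apply: leq_ltn_trans (ltn_ord i).
(* The first particle of a non-empty shape sits above [j], so its row, taken from an identity
   matrix, misses the columns [1, ..., j]. *)
have h0 : (0 < a (Ordinal j0))%N by apply: leq_trans hi (da _ _ _).
rewrite /pos_det (expand_det_row _ (Ordinal j0)) big1 // => l _.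
rewrite mxE /shape_pos kern0 ?sites_gt0 //.
- rewrite /= [_ == _](_ : _ = false) ?mul0r //; apply/eqP => /=; lia.
- by have := ltn_ord (a (Ordinal j0)); rewrite /m /=; lia.
- by have := ltn_ord l; rewrite /m /=; lia.
Qed.

Lemma shape_series (t : R) : 0 <= t ->
  series (fun n => (shape_cnt n empty)%:R * t ^+ n / n`!%:R) @ \oo -->
  \det (kern_mx m j t).
Proof.
move=> t0; rewrite -pos_det_empty.
pose w (e : bool * 'I_j) : pred shape :=
  fun a => if e.1 then addable a e.2 else removable a e.2.
pose tgt (e : bool * 'I_j) (a : shape) := if e.1 then up a e.2 else down a e.2.
have split_moves (V : nmodType) (F : shape -> V) (a : shape) :
    \sum_(e | w e a) F (tgt e a) =
    \sum_(i | addable a i) F (up a i) + \sum_(i | removable a i) F (down a i).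
  rewrite (bigID (fun e : bool * 'I_j => e.1)) /=; congr (_ + _).
    rewrite (reindex_onto (fun i => (true, i)) snd) /=; last by move=> [[] i] /andP[_].
    by apply: eq_bigl => i; rewrite /w /= eqxx !andbT.
  rewrite (reindex_onto (fun i => (false, i)) snd) /=; last by move=> [[] i] /andP[_].
  by apply: eq_bigl => i; rewrite /w /= eqxx !andbT.
apply: (@taylor_cvg R shape (bool * 'I_j)%type (@decr k j) w tgt
  (fun a => pos_det (shape_pos a)) (@shape_cnt k j)) => //.
- by move=> a [[] i] da; [apply: decr_up|apply: decr_down].
- move=> a s da; apply: (is_derive_eq (pos_det_derive _ s)).
  rewrite (split_moves _ (fun a => pos_det (shape_pos a) s)) big_split /=.
  congr (_ + _); rewrite [RHS]big_mkcond; apply: eq_bigr => i _.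
    exact: pos_det_up.
  exact: pos_det_down.
- by move=> a da; rewrite pos_det0 // shape_cnt0.
- by move=> n a da; rewrite shape_cntS // (split_moves _ (@shape_cnt k j n)).
- exact: decr_empty.
Qed.

End determinants_of_shapes.

(** * The probability *)

Section probability_of_box.
Variables (R : realType) (t : R) (d : measure_display) (T : measurableType d).
Variables (P : probability T R) (X : T -> {n : nat & matching n}).
Hypothesis t_gt0 : 0 < t.
Hypothesis hX : poissonized_matching P t X.

Notation pmf n := (poisson_pmf (t ^+ 2 / 2) n).

Lemma pmf_gt0 (n : nat) : 0 < pmf n.
Proof.
rewrite /poisson_pmf; have -> : 0 < t ^+ 2 / 2 by rewrite divr_gt0 ?exprn_gt0.
by rewrite !mulr_gt0 ?expR_gt0 ?invr_gt0 ?exprn_gt0 ?divr_gt0 ?exprn_gt0 // ltr0n fact_gt0.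
Qed.

Lemma prob_eq_matching (n : nat) (M : matching n) :
  P [set w | X w = Tagged matching M] = (pmf n / #|{: matching n}|%:R)%:E.
Proof.
case: hX => hm hp hu; have := hu n M; rewrite /cond_prob hp /=.
have -> : [set w | X w = Tagged matching M] `&` [set w | tag (X w) = n] =
          [set w | X w = Tagged matching M].
  by apply/seteqP; split => [w []|w /= e] //; split => //; rewrite e.
have fP : P [set w | X w = Tagged matching M] \is a fin_num.
  by apply: fin_num_measure; exact: (hm [set Tagged matching M]).
move=> e; rewrite -(fineK fP); congr (_%:E).
by rewrite -e; field; rewrite gt_eqF // pmf_gt0.
Qed.

Lemma prob_matchings (n : nat) (G : {set matching n}) :
  P [set w | exists2 M, M \in G & X w = Tagged matching M] =
  (#|G|%:R * (pmf n / #|{: matching n}|%:R))%:E.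
Proof.
pose F (M : matching n) := [set w | X w = Tagged matching M].
have -> : [set w | exists2 M, M \in G & X w = Tagged matching M] =
    \bigcup_(M in [set` G]) F M.
  by apply/seteqP; split => [w [M hM e]|w [M hM e]]; exists M.
rewrite measure_fin_bigcup //; last 2 first.
- move=> M M' _ _ [w [/= e1 e2]].
  by apply: eq_from_Tagged; rewrite -e1 e2.
- by case: hX => hm _ _ M _; exact: (hm [set Tagged matching M]).
rewrite -(@bigfs _ _ _ _ (enum G) (mem G)) ?enum_uniq //; last first.
  by move=> M h1; rewrite mem_enum => /negP[].
rewrite (eq_bigr (fun=> (pmf n / #|{: matching n}|%:R)%:E)) => [|M _]; last first.
  exact: prob_eq_matching.
rewrite sumEFin big_enum_cond /= sumr_const mulr_natl; congr (_ *+ _)%:E.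
by apply: eq_card => M; rewrite [LHS]andbb.
Qed.

Variables k j : nat.

Lemma prob_box :
  P [set w | (CR X w <= k)%N /\ (NE X w <= j)%N] =
  (expR (- (t ^+ 2 / 2)) * \det (kern_mx (j + k + 1) j t))%:E.
Proof.
pose G n := [set M : matching n | (cr M <= k)%N && (ne M <= j)%N]%SET.
pose E n := [set w | exists2 M, M \in G n & X w = Tagged matching M].
have -> : [set w | (CR X w <= k)%N /\ (NE X w <= j)%N] = \bigcup_n E n.
  apply/seteqP; split => w.
    rewrite /CR /NE => -[h1 h2]; exists (tag (X w)) => //.
    by exists (tagged (X w)); rewrite ?inE ?h1 ?h2 //; case: (X w).
  by move=> [n _ [M]]; rewrite inE /CR /NE => /andP[h1 h2] /= ->.
have mE n : measurable (E n).
  by case: hX => hm _ _; exact: (hm [set x | exists2 M, M \in G n & x = Tagged matching M]).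
have tE : trivIset setT E.
  by move=> n n' _ _ [w [[M _ e1] [M' _ e2]]]; have := congr1 tag e1; rewrite e2.
have := @measure_semi_sigma_additive _ _ _ P E mE tE (bigcup_measurable (fun n _ => mE n)).
pose a n : R := (@shape_cnt k j n (shape_of k j [::]))%:R * t ^+ n / n`!%:R.
have ca := @shape_series R k j t (ltW t_gt0); rewrite -/a in ca.
(* Dividing [(t^2/2)^n / n!] by the number [(2n)! / (2^n n!)] of matchings gives
   [t^(2n) / (2n)!]. *)
have PE n : P (E n) = (expR (- (t ^+ 2 / 2)) * a n.*2)%:E.
  rewrite prob_matchings; congr (_%:E); rewrite /a /G card_good_matchings.
  have cM : #|{: matching n}|%:R * (2 ^+ n * n`!%:R) = (n.*2)`!%:R :> R.
    by rewrite -card_matching natrM natrM natrX.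
  have t2 : t ^+ n.*2 = (t ^+ 2) ^+ n by rewrite -mul2n exprM.
  have M0 : #|{: matching n}|%:R != 0 :> R.
    apply/eqP => e; move/eqP: cM; rewrite e mul0r eq_sym pnatr_eq0.
    by rewrite -leqn0 leqNgt fact_gt0.
  rewrite /poisson_pmf; have -> : 0 < t ^+ 2 / 2 by rewrite divr_gt0 ?exprn_gt0.
  rewrite t2 -cM exprMn exprVn.
  have n0 : n`!%:R != 0 :> R by rewrite pnatr_eq0 -lt0n fact_gt0.
  have p0 : 2 ^+ n != 0 :> R by rewrite expf_neq0 // pnatr_eq0.
  move: (t ^+ 2 ^+ n) (2 ^+ n) (n`!%:R) p0 n0 => u v w v0 w0.
  by field; rewrite M0 v0 w0.
(* The odd terms of [a] vanish, so partial sums over sizes are the even-order partial sums of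
   [series a], a subsequence with the same limit. *)
have sumE N : (\sum_(0 <= i < N) P (E i))%E =
    (expR (- (t ^+ 2 / 2)) * series a N.*2)%:E.
  rewrite (eq_bigr (fun i => (expR (- (t ^+ 2 / 2)) * a i.*2)%:E)) => [|i _]; last exact: PE.
  rewrite sumEFin -mulr_sumr; congr (_ * _)%:E; rewrite /series /=.
  elim: N => [|N IH]; first by rewrite !big_geq.
  rewrite doubleS !big_nat_recr //= IH.
  by rewrite [a N.*2.+1]/a shape_cnt_odd !mul0r addr0.
rewrite (_ : (fun n : nat => _) = EFin \o (fun N => expR (- (t ^+ 2 / 2)) * series a N.*2)); last first.
  by apply/funext => N; rewrite sumE.
move=> cP; apply/esym.
have cD : (EFin \o (fun N => expR (- (t ^+ 2 / 2)) * series a N.*2)) n @[n --> \oo] -->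
   (expR (- (t ^+ 2 / 2)) * \det (kern_mx (j + k + 1) j t))%:E.
  apply: cvg_EFin; first exact: nearW.
  apply: cvgMr; apply: (cvg_comp _ _ _ ca).
  move=> A [M _ hM]; exists M => // n /= h; apply: hM => /=.
  by apply: leq_trans h _; rewrite -addnn leq_addr.
exact: (cvg_unique _ cD cP).
Qed.

End probability_of_box.

Section integration.
Variable R : realType.
Notation mu := (@lebesgue_measure R).

Lemma Rintegral_derive (F f : R -> R) (b : R) : 0 <= b ->
  (forall x : R, is_derive x 1 F (f x)) -> continuous f ->
  \int[mu]_(x in `[0, b]) f x = F b - F 0.
Proof.
move=> b0 hF cf; rewrite /Rintegral.
have [b1|b1] := eqVneq b 0.
  by rewrite b1 set_itv1 integral_set1 subrr.
have lt0b : 0 < b by rewrite lt_def b1.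
have cF := derive_continuous hF.
rewrite (@continuous_FTC2 R f F 0 b) //.
- exact: continuous_subspaceT.
- split.
  + by move=> x _; case: (hF x).
  + exact: cvg_at_right_filter (cF 0).
  + exact: cvg_at_left_filter (cF b).
- by move=> x _; rewrite derive1E; case: (hF x).
Qed.

Lemma cintegral_real (b : R) (f : R -> R[i]) (g : R -> R) :
  (forall s, 0 <= s <= b -> f s = (g s)%:C) ->
  cintegral 0 b f = (\int[mu]_(x in `[0, b]) g x)%:C.
Proof.
move=> h; rewrite /cintegral.
have hin s : s \in `[0, b]%classic -> f s = (g s)%:C.
  by rewrite inE /= in_itv /= => /h.
congr (_ +i* _).
  by apply: eq_Rintegral => s /hin ->.
have -> : \int[mu]_(x in `[0, b]) complex.Im (f x) = \int[mu]_(x in `[0, b]) (fun=> 0) x.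
  by apply: eq_Rintegral => s /hin ->.
by rewrite /Rintegral integral0.
Qed.

End integration.

Section continuity.
Variables (R : realType) (m : nat).
Hypothesis m_gt0 : (0 < m)%N.

(** The Schur flow does not cover the index [2m]. The quotient defining the coefficient is
    differentiated instead, which involves moments of the preceding index only. *)
Lemma verblunsky_continuous (n : nat) : (n <= m.*2)%N -> continuous (@verblunsky R m n).
Proof.
case: n => [|n] hn; first exact: cst_continuous.
have nz k (s : R) : (k < m.*2)%N -> opnorm m k s != 0.
  by move=> hk; rewrite gt_eqF // opnorm_gt0.
have dr (l : int) s := @pmom_derive R m m.*2 nz n s l hn.
rewrite (_ : verblunsky m n.+1 = (fun t => - pmom m n t (-1) / opnorm m n t)); last first.
  by apply/funext => s; rewrite verblunskyS.
exact: (derive_continuous (fun s => is_derive_mulf (is_derive_oppf (dr (-1) s)) (is_derive_invf (nz n s hn) (dr n s)))).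
Qed.

End continuity.

Theorem proposition1p1 (R : realType) (j k : nat) (t : R) (ht : 0 < t)
    (d : measure_display) (T : measurableType d) (P : probability T R)
    (X : T -> {n : nat & matching n}) (hX : poissonized_matching P t X) :
  let m := (j + k + 1)%N in
  (ln (fine (P [set w | (CR X w <= k)%N /\ (NE X w <= j)%N])))%:C
  = cintegral 0 t (fun tau => (orthopoly j.*2.+1 m tau).[0])
    + cintegral 0 t (fun s => cintegral 0 s (fun tau => Qfun j m tau)).
Proof.
move=> m; have m0 : (0 < m)%N by rewrite /m addn1.
have jm : (j < m)%N by rewrite /m addn1 ltnS leq_addr.
pose x n := @verblunsky R m n.
pose Q (s : R) : R := - (x j.*2 s * x j.*2.+2 s + x j.*2.+1 s ^+ 2) +
     x j.*2 s * x j.*2.+2 s * x j.*2.+1 s ^+ 2.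
(* The term [- s] is the derivative of the exponent [- s^2/2] of the Poisson factor; with it [Phi]
   vanishes at 0 and has derivative [Q]. *)
pose Phi (s : R) : R := - (\sum_(n < j.*2.+1) x n s * x n.+1 s) - s.
have QE s : Qfun j m s = (Q s)%:C.
  rewrite /Qfun !orthopoly_at0 //; try lia.
  rewrite -add_Re2_Im2 /= expr0n addr0 /Q.
  by rewrite !(rmorphD, rmorphN, rmorphM).
have cx n : (n <= m.*2)%N -> continuous (x n) by apply: verblunsky_continuous.
have cQ : continuous Q.
  have c0 : continuous (x j.*2) by apply: cx; lia.
  have c1 : continuous (x j.*2.+1) by apply: cx; lia.
  have c2 : continuous (x j.*2.+2) by apply: cx; lia.
  have c3 : continuous (fun s => x j.*2 s * x j.*2.+2 s).
    by move=> s; apply: cvgM; [exact: c0|exact: c2].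
  have c4 : continuous (fun s => x j.*2.+1 s ^+ 2).
    by move=> s; apply: cvgM; exact: c1.
  move=> s; apply: cvgD; last by apply: cvgM; [exact: c3|exact: c4].
  by apply: cvgN; apply: cvgD; [exact: c3|exact: c4].
have inner s : 0 <= s <= t -> cintegral 0 s (fun tau => Qfun j m tau) = (Phi s)%:C.
  case/andP=> s0 _; rewrite (cintegral_real (g := Q)) => [|u _]; last exact: QE.
  rewrite (Rintegral_derive s0 (fun u => verblunsky_sum_derive m0 u jm) cQ).
  by rewrite verblunsky_sum0 // subr0.
have cPhi : continuous Phi := derive_continuous (fun u => verblunsky_sum_derive m0 u jm).
have cx1 : continuous (x j.*2.+1) by apply: cx; lia.
rewrite (cintegral_real (g := x j.*2.+1)) => [|u _]; last by rewrite orthopoly_at0 //; lia.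
rewrite (cintegral_real (g := Phi)) // -rmorphD; congr (_%:C).
pose L (s : R) := ln (\det (kern_mx m j s)).
have dL (s : R) : is_derive s 1 L (x j.*2.+1 s - \sum_(n < j.*2.+1) x n s * x n.+1 s).
  exact: ln_det_derive.
have t0 := ltW ht.
have integ (f : R -> R) : continuous f -> (@lebesgue_measure R).-integrable `[0, t] (EFin \o f).
  move=> cf; apply: continuous_compact_integrable; first exact: segment_compact.
  exact: continuous_subspaceT.
rewrite -RintegralD //; [|exact: integ..].
have dLt (s : R) : is_derive s 1 (fun u => L u - u ^+ 2 / 2) (x j.*2.+1 s + Phi s).
  have d2 : is_derive s 1 (fun u : R => u * u / 2) s.
    apply: (is_derive_eq (is_derive_mulf (is_derive_mulf (is_derive_id s 1) (is_derive_id s 1)) (is_derive_cstf s 2^-1))).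
    by rewrite /=; field.
  apply: (is_derive_eq (is_derive_subf (dL s) d2)).
  by rewrite /Phi; ring.
have cf : continuous (fun s => x j.*2.+1 s + Phi s).
  by move=> s; apply: cvgD; [exact: cx1|exact: cPhi].
rewrite (Rintegral_derive t0 dLt cf) (prob_box ht hX) /=.
have dp := det_kern_mx_gt0 m0 t jm.
rewrite lnM ?posrE ?expR_gt0 // expRK /L kern_mx0 // det1 ln1.
by rewrite expr0n /= mul0r !subr0 addrC.
Qed.
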